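(* Let $D=\left(\frac{a,b}{K}\right)$ be a quaternion division algebra over $K$ with $a,b\in\mathcal{O}_K^*$, with $K$-basis $1,x,y,z$ where $x^2=a$, $y^2=b$, $z=xy=-yx$, and let $\tau$ be its canonical involution. Take $\epsilon=1$, $\sigma=\tau_x$ and $\pi'=\pi$, so that $\sigma_{\pi'}=\tau_x$. Then Larmour's isomorphism $\partial=(\partial_0,\partial_1)$ is an isomorphism $$W^{1}\left(\left(\tfrac{a,b}{K}\right),\tau_x\right)\cong W^{1}\left(\left(\tfrac{\overline a,\overline b}{k}\right),\overline{\tau_x}\right)\oplus W^{1}\left(\left(\tfrac{\overline a,\overline b}{k}\right),\overline{\tau_x}\right),$$ and on one-dimensional forms it is given as follows. For $\delta,\beta,\gamma\in\mathcal{O}_K$ with $\delta+\beta y+\gamma z\in\mathcal{O}_D^*$, the image of the unramified hermitian form $\langle\delta+\beta y+\gamma z\rangle$ under $\partial_0$ is $\langle\overline{\delta+\beta y+\gamma z}\rangle$. For $\delta,\beta,\gamma\in m_K$ with $\nu_D(\delta+\beta y+\gamma z)=1$, the image of the ramified hermitian form $\langle\delta+\beta y+\gamma z\rangle$ under $\partial_1$ is $\langle\overline{\pi^{-1}(\delta+\beta y+\gamma z)}\rangle$.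
   Context: $K$ is a complete discretely valued field with normalized valuation $\nu_K$, valuation ring $\mathcal{O}_K$, maximal ideal $m_K$, uniformizer $\pi$ and residue field $k$ of characteristic $\neq2$. $\nu_D(d)=\frac12\nu_K(\mathrm{Nrd}(d))$ extends $\nu_K$ to $D$; $\mathcal{O}_D=\{\nu_D\ge0\}$, $m_D=\{\nu_D>0\}$ (both with $0$), $\overline D=\mathcal{O}_D/m_D$, and a bar denotes reduction modulo $m_D$. When $a,b$ are units, $\overline D\cong\left(\frac{\overline a,\overline b}{k}\right)$, a quaternion division algebra, and $\nu_D$ has value group $\mathbb{Z}$. Every $K$-linear involution $\sigma$ of $D$ preserves $\mathcal{O}_D,m_D$ and induces $\overline\sigma$ on $\overline D$. $\tau(x)=-x$, $\tau(y)=-y$, $\tau(z)=-z$. For $\lambda\in D^*$, $\sigma_\lambda(d)=\lambda\sigma(d)\lambda^{-1}$. $W^\epsilon(E,\rho)$ is the Witt group of nondegenerate $\epsilon$-hermitian forms over a division algebra with involution $(E,\rho)$, and $\langle u_1,\dots,u_r\rangle$ is the diagonal form with $\rho(u_i)=\epsilon u_i$. Larmour's isomorphism: given an $\epsilon$-symmetric uniformizer $\pi'$ of $D$ (i.e. $\sigma(\pi')=\epsilon\pi'$ and $\nu_D(\pi')$ is the least positive value of $\nu_D$), every $\epsilon$-hermitian form over $(D,\sigma)$ is isometric to $h_0\perp h_1$ with $h_0=\langle u_1,\dots,u_p\rangle$, $\nu_D(u_i)=0$ (unramified), and $h_1=\langle v_1,\dots,v_q\rangle$, $\nu_D(v_i)=\nu_D(\pi')$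 (ramified). Set $\overline{h_0}=\langle\overline{u_1},\dots,\overline{u_p}\rangle$ and $\overline{h_1}=\langle\overline{v_1\pi'^{-1}},\dots,\overline{v_q\pi'^{-1}}\rangle$. Then $\partial:W^\epsilon(D,\sigma)\to W^\epsilon(\overline D,\overline\sigma)\oplus W^1(\overline D,\overline{\sigma_{\pi'}})$, $[h]\mapsto([\overline{h_0}],[\overline{h_1}])$, is Larmour's (well-defined) group isomorphism. *)

(* Defs.v *)
From HB Require Import structures.
From mathcomp Require Import all_boot all_order all_algebra.
From mathcomp Require Import generic_quotient ring_quotient boolp.
From mathcomp Require Import ring zify.

Set Implicit Arguments.
Unset Strict Implicit.
Unset Printing Implicit Defensive.

Import Order.TTheory GRing.Theory Num.Theory.
Local Open Scope ring_scope.
Local Open Scope quotient_scope.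

(* Only the values of [nu] at nonzero elements are meaningful; the usual
   convention nu 0 = +oo is made explicit wherever it is needed. *)
Definition vge (K : fieldType) (nu : K -> int) (n : int) (x : K) : bool :=
  (x == 0) || (n <= nu x).

Record cdvaluation (K : fieldType) := CDValuation {
  cdv_fun :> K -> int;
  cdvM : forall x y, x != 0 -> y != 0 -> cdv_fun (x * y) = cdv_fun x + cdv_fun y;
  cdvD : forall x y, x != 0 -> y != 0 -> x + y != 0 ->
    Num.min (cdv_fun x) (cdv_fun y) <= cdv_fun (x + y);
  cdv_normalized : exists2 t, t != 0 & cdv_fun t = 1;
  cdv_complete : forall u : nat -> K,
    (forall N : int, exists n0 : nat, forall m n : nat,
       (n0 <= m)%N -> (n0 <= n)%N -> vge cdv_fun N (u m - u n)) ->
    exists l : K, forall N : int, exists n0 : nat, forall n : nat,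
       (n0 <= n)%N -> vge cdv_fun N (u n - l)
}.

Section ResidueField.
Variables (K : fieldType) (nu : cdvaluation K).

Definition vring : {pred K} := fun x => vge nu 0 x.
Definition vmax : {pred K} := fun x => vge nu 1 x.

Lemma cdv1 : nu 1 = 0.
Proof.
have := cdvM nu (oner_neq0 K) (oner_neq0 K); rewrite mul1r => h.
by apply: (addrI (nu 1)); rewrite addr0 -h.
Qed.

Lemma cdvN x : nu (- x) = nu x.
Proof.
have [->|x0] := eqVneq x 0; first by rewrite oppr0.
have n1 : (-1 : K) != 0 by rewrite oppr_eq0 oner_neq0.
have h : nu (-1) = 0 by have := cdvM nu n1 n1; rewrite mulrNN mul1r cdv1; lia.
by rewrite -mulN1r cdvM // h add0r.
Qed.

Lemma cdvV x : x != 0 -> nu x^-1 = - nu x.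
Proof.
move=> x0; have := cdvM nu x0 (invr_neq0 x0).
by rewrite divff // cdv1; lia.
Qed.

Lemma vgeD n x y : vge nu n x -> vge nu n y -> vge nu n (x + y).
Proof.
rewrite /vge; have [->|x0] /= := eqVneq x 0; first by rewrite add0r.
have [->|y0] /= := eqVneq y 0; first by rewrite addr0 (negPf x0).
have [//|s0] /= := eqVneq (x + y) 0 => hx hy.
by apply: le_trans _ (cdvD nu x0 y0 s0); rewrite le_min hx.
Qed.

Lemma vgeN n x : vge nu n (- x) = vge nu n x.
Proof. by rewrite /vge oppr_eq0 cdvN. Qed.

Lemma vgeM m n x y : vge nu m x -> vge nu n y -> vge nu (m + n) (x * y).
Proof.
rewrite /vge; have [->|x0] /= := eqVneq x 0; first by rewrite mul0r eqxx.
have [->|y0] /= := eqVneq y 0; first by rewrite mulr0 eqxx.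
by move=> hx hy; rewrite cdvM // lerD ?orbT.
Qed.

Lemma vring_subring : subring_closed vring.
Proof.
split=> [|x y hx hy|x y hx hy]; rewrite -topredE /= /vring.
- by rewrite /vge cdv1 lexx orbT.
- by apply: vgeD => //; rewrite vgeN.
- by rewrite -[0]addr0; apply: vgeM.
Qed.

HB.instance Definition _ := GRing.isSubringClosed.Build K vring vring_subring.

Record vinteger := VInteger { vint_val : K; vint_valP : vint_val \in vring }.

HB.instance Definition _ := [isSub for vint_val].
HB.instance Definition _ := [Choice of vinteger by <:].
HB.instance Definition _ := [SubChoice_isSubComNzRing of vinteger by <:].

Definition vmax_ideal : {pred vinteger} := fun x => val x \in vmax.

Lemma vringE x : (x \in vring) = vge nu 0 x. Proof. by []. Qed.
Lemma vmax_idealE x : (x \in vmax_ideal) = vge nu 1 (val x). Proof. by []. Qed.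

Lemma vmax_idealP : idealr_closed vmax_ideal.
Proof.
split=> [||a x y hx hy]; rewrite vmax_idealE.
- by rewrite /vge rmorph0 eqxx.
- by rewrite /vge rmorph1 oner_eq0 /= cdv1.
- rewrite rmorphD rmorphM; apply: vgeD => //.
  by rewrite -[1]add0r; apply: vgeM => //; apply: (valP a).
Qed.

HB.instance Definition _ := isIdealr.Build vinteger vmax_ideal vmax_idealP.

Definition residue_field := {ideal_quot vmax_ideal}.

HB.instance Definition _ := GRing.ComNzRing.on residue_field.

(* Reduction modulo the maximal ideal; elements outside the valuation ring are
   sent to 0. *)
Definition residue (x : K) : residue_field :=
  \pi_residue_field (insubd (0 : vinteger) x).

Lemma residue_eq0 (x : vinteger) :
  (\pi_residue_field x == 0) = (x \in vmax_ideal).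
Proof. by rewrite piE /= Quotient.equivE subr0. Qed.

Lemma residue0 : residue 0 = 0.
Proof.
apply: (etrans _ (raddf0 \pi_residue_field)); congr (\pi_residue_field _).
by apply: val_inj; rewrite val_insubd rpred0.
Qed.

Lemma residue_repr (x : residue_field) : residue (val (repr x)) = x.
Proof. by rewrite /residue valKd reprK. Qed.

Lemma repr_eq0 (x : residue_field) : (x == 0) = vge nu 1 (val (repr x)).
Proof. by rewrite -{1}[x]reprK residue_eq0 vmax_idealE. Qed.

Definition residue_inv (x : residue_field) : residue_field :=
  residue (val (repr x))^-1.

Lemma residue_mulVf : forall x, x != 0 -> residue_inv x * x = 1.
Proof.
move=> x; rewrite repr_eq0 /residue_inv -{3}[x]reprK; move: (repr x) => r.
rewrite /vge negb_or => /andP[r0 hr].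
have nr : nu (val r) = 0.
  have := valP r; rewrite vringE /vge (negPf r0) orFb.
  by move: hr; lia.
have hi : (val r)^-1 \in vring.
  by rewrite vringE /vge cdvV // nr oppr0 lexx orbT.
rewrite /residue -rmorphM; apply: (etrans _ (rmorph1 \pi_residue_field)); congr (\pi_residue_field _).
by apply: val_inj; rewrite rmorphM rmorph1 /= val_insubd hi mulVf.
Qed.

Lemma residue_inv0 : residue_inv 0 = 0.
Proof.
rewrite /residue_inv; have : vge nu 1 (val (repr (0 : residue_field))).
  by rewrite -repr_eq0.
move: (val _) => r; have [->|r0] := eqVneq r 0; first by rewrite invr0 residue0.
rewrite /vge (negPf r0) /= => hr.
rewrite /residue /insubd insubN /= ?rmorph0 // vringE /vge.
by rewrite invr_eq0 (negPf r0) cdvV //=; lia.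
Qed.

HB.instance Definition _ :=
  GRing.ComNzRing_isField.Build residue_field residue_mulVf residue_inv0.

Definition vunit (x : K) : bool := (x \in vring) && (x != 0) && (x^-1 \in vring).

Lemma vunit_neq0 x : vunit x -> x != 0.
Proof. by case/andP=> /andP[]. Qed.

Lemma residue_neq0 x : vunit x -> residue x != 0.
Proof.
case/andP=> /andP[hx x0 hi]; rewrite /residue residue_eq0.
rewrite vmax_idealE /vge val_insubd hx (negPf x0) /=.
by move: hi; rewrite vringE /vge invr_eq0 (negPf x0) cdvV //=; lia.
Qed.

End ResidueField.

Arguments vring {K} nu.
Arguments vmax {K} nu.
Arguments residue {K} nu x.
Arguments vunit {K} nu x.

(* The quaternion algebra (a, b / F), with basis 1, x, y, z = x * y. *)
Record quat (F : fieldType) (a b : F) :=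
  Quat { quat1 : F; quatx : F; quaty : F; quatz : F }.

Arguments Quat {F} a b.

Section QuaternionAlgebra.
Variables (F : fieldType) (a b : F).
Local Notation D := (quat a b).
Implicit Types p q r : D.

Definition quat_tuple p := (quat1 p, quatx p, quaty p, quatz p).
Definition tuple_quat (t : F * F * F * F) : D :=
  let: (c1, cx, cy, cz) := t in Quat a b c1 cx cy cz.
Lemma quat_tupleK : cancel quat_tuple tuple_quat. Proof. by case. Qed.
HB.instance Definition _ := Choice.copy D (can_type quat_tupleK).

Lemma quatP p q : quat1 p = quat1 q -> quatx p = quatx q ->
  quaty p = quaty q -> quatz p = quatz q -> p = q.
Proof. by case: p q => ? ? ? ? [? ? ? ?] /= -> -> -> ->. Qed.

Definition quat_zero : D := Quat a b 0 0 0 0.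
Definition quat_opp p : D :=
  Quat a b (- quat1 p) (- quatx p) (- quaty p) (- quatz p).
Definition quat_add p q : D :=
  Quat a b (quat1 p + quat1 q) (quatx p + quatx q)
           (quaty p + quaty q) (quatz p + quatz q).

Fact quat_addA : associative quat_add.
Proof. by move=> p q r; apply: quatP => /=; ring. Qed.
Fact quat_addC : commutative quat_add.
Proof. by move=> p q; apply: quatP => /=; ring. Qed.
Fact quat_add0 : left_id quat_zero quat_add.
Proof. by move=> p; apply: quatP => /=; ring. Qed.
Fact quat_addN : left_inverse quat_zero quat_opp quat_add.
Proof. by move=> p; apply: quatP => /=; ring. Qed.

HB.instance Definition _ :=
  GRing.isZmodule.Build D quat_addA quat_addC quat_add0 quat_addN.

Definition quat_one : D := Quat a b 1 0 0 0.

(* The bilinear extension of x^2 = a, y^2 = b, xy = z = - yx, whence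
   z^2 = - ab, xz = ay = - zx and zy = bx = - yz. *)
Definition quat_mul p q : D :=
  let: Quat p1 px py pz := p in let: Quat q1 qx qy qz := q in
  Quat a b
    (p1 * q1 + a * (px * qx) + b * (py * qy) - a * b * (pz * qz))
    (p1 * qx + px * q1 + b * (pz * qy - py * qz))
    (p1 * qy + py * q1 + a * (px * qz - pz * qx))
    (p1 * qz + pz * q1 + (px * qy - py * qx)).

Fact quat_mulA : associative quat_mul.
Proof. by do 3!case=> ? ? ? ?; apply: quatP => /=; ring. Qed.
Fact quat_mul1l : left_id quat_one quat_mul.
Proof. by case=> ? ? ? ?; apply: quatP => /=; ring. Qed.
Fact quat_mul1r : right_id quat_one quat_mul.
Proof. by case=> ? ? ? ?; apply: quatP => /=; ring. Qed.
Fact quat_mulDl : left_distributive quat_mul +%R.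
Proof. by do 3!case=> ? ? ? ?; apply: quatP => /=; ring. Qed.
Fact quat_mulDr : right_distributive quat_mul +%R.
Proof. by do 3!case=> ? ? ? ?; apply: quatP => /=; ring. Qed.
Fact quat_1_neq0 : quat_one != 0.
Proof. by apply/eqP => -[/eqP]; rewrite oner_eq0. Qed.

HB.instance Definition _ := GRing.Zmodule_isNzRing.Build D
  quat_mulA quat_mul1l quat_mul1r quat_mulDl quat_mulDr quat_1_neq0.

Definition quat_scale (c : F) p : D :=
  Quat a b (c * quat1 p) (c * quatx p) (c * quaty p) (c * quatz p).

Fact quat_scaleA c d p : quat_scale c (quat_scale d p) = quat_scale (c * d) p.
Proof. by apply: quatP => /=; ring. Qed.
Fact quat_scale1 : left_id 1 quat_scale.
Proof. by move=> p; apply: quatP => /=; ring. Qed.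
Fact quat_scaleDr : right_distributive quat_scale +%R.
Proof. by move=> c p q; apply: quatP => /=; ring. Qed.
Fact quat_scaleDl p : {morph quat_scale^~ p : c d / c + d}.
Proof. by move=> c d; apply: quatP => /=; ring. Qed.

HB.instance Definition _ := GRing.Zmodule_isLmodule.Build F D
  quat_scaleA quat_scale1 quat_scaleDr quat_scaleDl.

Fact quat_scaleAl (c : F) p q : c *: (p * q) = (c *: p) * q.
Proof. by case: p q => ? ? ? ? [? ? ? ?]; apply: quatP => /=; ring. Qed.
HB.instance Definition _ := GRing.Lmodule_isLalgebra.Build F D quat_scaleAl.

Fact quat_scaleAr (c : F) p q : c *: (p * q) = p * (c *: q).
Proof. by case: p q => ? ? ? ? [? ? ? ?]; apply: quatP => /=; ring. Qed.
HB.instance Definition _ := GRing.Lalgebra_isAlgebra.Build F D quat_scaleAr.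

Definition qx : D := Quat a b 0 1 0 0.
Definition qy : D := Quat a b 0 0 1 0.
Definition qz : D := Quat a b 0 0 0 1.

Definition quat_conj p : D :=
  Quat a b (quat1 p) (- quatx p) (- quaty p) (- quatz p).

(* The reduced norm. *)
Definition Nrd p : F :=
  quat1 p ^+ 2 - a * quatx p ^+ 2 - b * quaty p ^+ 2 + a * b * quatz p ^+ 2.

Lemma quat_basis p :
  p = (quat1 p)%:A + quatx p *: qx + quaty p *: qy + quatz p *: qz.
Proof. by apply: quatP => /=; ring. Qed.

Lemma quat_relations :
  [/\ qx * qx = a%:A, qy * qy = b%:A, qx * qy = qz & qy * qx = - qz].
Proof. by split; apply: quatP => /=; ring. Qed.

Lemma NrdE p : p * quat_conj p = (Nrd p)%:A.
Proof. by case: p => ? ? ? ?; rewrite /Nrd; apply: quatP => /=; ring. Qed.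

Lemma NrdEl p : quat_conj p * p = (Nrd p)%:A.
Proof. by case: p => ? ? ? ?; rewrite /Nrd; apply: quatP => /=; ring. Qed.

Lemma NrdM p q : Nrd (p * q) = Nrd p * Nrd q.
Proof. by case: p q => ? ? ? ? [? ? ? ?]; rewrite /Nrd /=; ring. Qed.

Definition quat_unit : {pred D} := fun p => Nrd p != 0.
Definition quat_inv p : D := if p \in quat_unit then (Nrd p)^-1 *: quat_conj p else p.

Fact quat_mulVr : {in quat_unit, left_inverse 1 quat_inv *%R}.
Proof.
move=> p hp; rewrite /quat_inv hp -scalerAl NrdEl scalerA mulVf ?scale1r //.
Qed.
Fact quat_divrr : {in quat_unit, right_inverse 1 quat_inv *%R}.
Proof.
move=> p hp; rewrite /quat_inv hp -scalerAr NrdE scalerA mulVf ?scale1r //.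
Qed.
Fact quat_unitP p q : q * p = 1 /\ p * q = 1 -> p \in quat_unit.
Proof.
case=> h _; have : Nrd (q * p) = 1 by rewrite h /Nrd /=; ring.
rewrite NrdM => h1; rewrite /quat_unit -topredE /=; apply: contra_eq_neq h1 => ->.
by rewrite mulr0 eq_sym oner_neq0.
Qed.
Fact quat_inv_out : {in [predC quat_unit], quat_inv =1 id}.
Proof. by move=> p /negPf hp; rewrite /quat_inv hp. Qed.

HB.instance Definition _ := GRing.NzRing_hasMulInverse.Build D
  quat_mulVr quat_divrr quat_unitP quat_inv_out.

End QuaternionAlgebra.

Arguments qx {F} a b.
Arguments qy {F} a b.
Arguments qz {F} a b.

Definition is_division (E : unitRingType) :=
  forall d : E, d != 0 -> d \is a GRing.unit.

Record involution (E : nzRingType) := Involution {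
  invol_fun :> E -> E;
  involD : {morph invol_fun : d d' / d + d'};
  involM : forall d d', invol_fun (d * d') = invol_fun d' * invol_fun d;
  involK : involutive invol_fun
}.

Section InvolutionTheory.
Variables (E : unitRingType) (rho : involution E).

Lemma invol0 : rho 0 = 0.
Proof. by apply: (addrI (rho 0)); rewrite -involD !addr0. Qed.
Lemma involN d : rho (- d) = - rho d.
Proof. by apply: (addrI (rho d)); rewrite -involD !subrr invol0. Qed.
Lemma invol1 : rho 1 = 1.
Proof. by have := involM rho (rho 1) 1; rewrite mulr1 involK mulr1. Qed.
Lemma invol_sum I (s : seq I) (P : pred I) (f : I -> E) :
  rho (\sum_(i <- s | P i) f i) = \sum_(i <- s | P i) rho (f i).
Proof. exact: (big_morph rho (involD rho) invol0). Qed.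
Lemma invol_sign (e : bool) : rho ((-1) ^+ e) = (-1) ^+ e.
Proof. by case: e; rewrite ?expr0 ?expr1 ?involN invol1. Qed.
Lemma invol_signM (e : bool) d : rho ((-1) ^+ e * d) = (-1) ^+ e * rho d.
Proof. by case: e; rewrite ?mul1r ?mulN1r ?involN. Qed.
Lemma involV d : d \is a GRing.unit -> rho d^-1 = (rho d)^-1.
Proof.
move=> hd; have h : rho d^-1 * rho d = 1 by rewrite -involM divrr // invol1.
have h' : rho d * rho d^-1 = 1 by rewrite -involM mulVr // invol1.
have hu : rho d \is a GRing.unit by apply/unitrP; exists (rho d^-1).
by rewrite -[RHS]mul1r -h mulrK.
Qed.

Definition twist (lam d : E) : E := lam * rho d * lam^-1.

Section Twist.
Variables (lam : E) (lamU : lam \is a GRing.unit) (e : bool).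
Hypothesis lamE : rho lam = (-1) ^+ e * lam.

Lemma twistD : {morph twist lam : d d' / d + d'}.
Proof. by move=> d d'; rewrite /twist involD mulrDr mulrDl. Qed.
Lemma twistM d d' : twist lam (d * d') = twist lam d' * twist lam d.
Proof. by rewrite /twist involM !mulrA mulrVK. Qed.
Lemma twistK : involutive (twist lam).
Proof.
move=> d; rewrite /twist !involM involK involV // lamE.
have -> : ((-1) ^+ e * lam)^-1 = (-1) ^+ e * lam^-1.
  by case: (e); rewrite ?expr0 ?expr1 ?mul1r // !mulN1r invrN.
have -> : (-1) ^+ e * lam^-1 * (d * ((-1) ^+ e * lam)) = lam^-1 * (d * lam).
  by case: (e); rewrite ?expr0 ?expr1 ?mul1r // !mulN1r !mulrN mulNr opprK.
by rewrite !mulrA divrr // mul1r mulrK.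
Qed.
Definition twist_involution := Involution twistD twistM twistK.
End Twist.

End InvolutionTheory.

Section QuaternionInvolutions.
Variables (F : fieldType) (a b : F).

Fact quat_conjD : {morph @quat_conj F a b : d d' / d + d'}.
Proof. by move=> p q; apply: quatP => /=; ring. Qed.
Fact quat_conjM (p q : quat a b) : quat_conj (p * q) = quat_conj q * quat_conj p.
Proof. by case: p q => ? ? ? ? [? ? ? ?]; apply: quatP => /=; ring. Qed.
Fact quat_conjK : involutive (@quat_conj F a b).
Proof. by move=> p; apply: quatP => /=; rewrite ?opprK. Qed.

Definition tau : involution (quat a b) := Involution quat_conjD quat_conjM quat_conjK.

Fact qx_unit : a != 0 -> qx a b \is a GRing.unit.
Proof.
have -> : (qx a b \is a GRing.unit) = (Nrd (qx a b) != 0) by [].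
suff -> : Nrd (qx a b) = - a by rewrite oppr_eq0.
by rewrite /Nrd /=; ring.
Qed.
Fact tau_qx : tau (qx a b) = (-1) ^+ true * qx a b.
Proof. by apply: quatP => /=; ring. Qed.

Definition tau_x (a0 : a != 0) : involution (quat a b) :=
  twist_involution (qx_unit a0) tau_qx.

End QuaternionInvolutions.

Arguments tau {F} a b.
Arguments tau_x {F a} b a0.

(* Nondegenerate (-1)^e-hermitian forms on the left vector spaces E^n.  Every
   form over a division ring E is isometric to one of these. *)
Record herm_form (E : unitRingType) (rho : involution E) (e : bool) := HermForm {
  hdim : nat;
  hval :> 'rV[E]_hdim -> 'rV[E]_hdim -> E;
  hform_linear : forall c u v w, hval (c *: u + v) w = c * hval u w + hval v w;
  hform_sym : forall v w, hval v w = (-1) ^+ e * rho (hval w v);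
  hform_nondeg : forall v, (forall w, hval v w = 0) -> v = 0
}.

Section HermitianForms.
Variables (E : unitRingType) (rho : involution E) (e : bool).
Local Notation form := (herm_form rho e).
Implicit Types h k : form.

HB.instance Definition _ := gen_eqMixin form.
HB.instance Definition _ := gen_choiceMixin form.

Definition isometry h k : Prop :=
  exists f : 'rV[E]_(hdim h) -> 'rV[E]_(hdim k),
    [/\ forall c u v, f (c *: u + v) = c *: f u + f v, bijective f
      & forall v w, k (f v) (f w) = h v w].

Lemma isometry_refl h : isometry h h.
Proof. by exists id; split=> //; exists id. Qed.

Lemma isometry_sym h k : isometry h k -> isometry k h.
Proof.
case=> f [lf [g fK gK] fh]; exists g; split; last by move=> v w; rewrite -fh !gK.
- by move=> c u v; rewrite -{1}[u]gK -{1}[v]gK -lf fK.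
- by exists f.
Qed.

Lemma isometry_trans h k l : isometry h k -> isometry k l -> isometry h l.
Proof.
case=> f [lf bf fh] [g [lg bg gh]]; exists (g \o f); split.
- by move=> c u v /=; rewrite lf lg.
- exact: bij_comp.
- by move=> v w /=; rewrite gh fh.
Qed.

(* The orthogonal sum. *)
Section OrthogonalSum.
Variables h k : form.

Definition osum_val (v w : 'rV[E]_(hdim h + hdim k)) : E :=
  h (lsubmx v) (lsubmx w) + k (rsubmx v) (rsubmx w).

Lemma hform0l h' w : h' 0 w = 0.
Proof.
have := @hform_linear _ _ _ h' 1 0 0 w; rewrite scaler0 addr0 mul1r => h0.
by apply: (addrI (h' 0 w)); rewrite addr0 -h0.
Qed.
Lemma hform0r h' w : h' w 0 = 0.
Proof. by rewrite hform_sym hform0l invol0 mulr0. Qed.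

Fact osum_linear c u v w :
  osum_val (c *: u + v) w = c * osum_val u w + osum_val v w.
Proof. by rewrite /osum_val !linearP !hform_linear mulrDr addrACA. Qed.
Fact osum_sym v w : osum_val v w = (-1) ^+ e * rho (osum_val w v).
Proof. by rewrite /osum_val involD mulrDr -!hform_sym. Qed.
Fact osum_nondeg v : (forall w, osum_val v w = 0) -> v = 0.
Proof.
move=> v0; rewrite -[v]hsubmxK; apply/eqP; rewrite row_mx_eq0; apply/andP; split; apply/eqP.
- apply: hform_nondeg => w; have := v0 (row_mx w 0).
  by rewrite /osum_val row_mxKl row_mxKr hform0r addr0.
- apply: hform_nondeg => w; have := v0 (row_mx 0 w).
  by rewrite /osum_val row_mxKl row_mxKr hform0r add0r.
Qed.
Definition osum : form := HermForm osum_linear osum_sym osum_nondeg.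
End OrthogonalSum.

Fact fzero_linear (c : E) (u v w : 'rV[E]_0) : (0 : E) = c * 0 + 0.
Proof. by rewrite mulr0 addr0. Qed.
Fact fzero_sym (v w : 'rV[E]_0) : (0 : E) = (-1) ^+ e * rho 0.
Proof. by rewrite invol0 mulr0. Qed.
Fact fzero_nondeg (v : 'rV[E]_0) : ('rV[E]_0 -> (0 : E) = 0) -> v = 0.
Proof. by rewrite [v]thinmx0. Qed.
Definition fzero : form := HermForm fzero_linear fzero_sym fzero_nondeg.

(* The entries of diagonal forms. *)
Record symunit := SymUnit {
  suval : E;
  suP : (rho suval == (-1) ^+ e * suval) && (suval \is a GRing.unit)
}.

Section Diagonal.
Variables (n : nat) (u : 'I_n -> symunit).
Definition diag_val (v w : 'rV[E]_n) : E := \sum_i v 0 i * suval (u i) * rho (w 0 i).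
Fact diag_linear c v v' w :
  diag_val (c *: v + v') w = c * diag_val v w + diag_val v' w.
Proof.
rewrite /diag_val mulr_sumr -big_split; apply: eq_bigr => i _ /=.
by rewrite !mxE !mulrDl !mulrA.
Qed.
Lemma sign_comm (c d : E) : c * ((-1) ^+ e * d) = (-1) ^+ e * (c * d).
Proof. by rewrite mulr_sign !mulr_sign; case: e => //; rewrite mulrN. Qed.
Lemma signK (d : E) : (-1) ^+ e * ((-1) ^+ e * d) = d.
Proof. by rewrite mulrA -expr2 sqrr_sign mul1r. Qed.
Fact diag_sym v w : diag_val v w = (-1) ^+ e * rho (diag_val w v).
Proof.
rewrite /diag_val invol_sum mulr_sumr; apply: eq_bigr => i _.
have /andP[/eqP hu _] := suP (u i).
by rewrite !involM involK hu -(mulrA ((-1) ^+ e)) sign_comm signK mulrA.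
Qed.
Fact diag_nondeg v : (forall w, diag_val v w = 0) -> v = 0.
Proof.
move=> v0; apply/rowP => j; rewrite mxE; have := v0 (delta_mx 0 j).
rewrite /diag_val (bigD1 j) //= big1 => [|i ij].
  rewrite mxE !eqxx invol1 mulr1 addr0 => h.
  have /andP[_ hu] := suP (u j).
  by rewrite -[LHS](mulrK hu) h mul0r.
by rewrite mxE (negPf ij) andbF invol0 mulr0.
Qed.
Definition diag_form : form := HermForm diag_linear diag_sym diag_nondeg.
End Diagonal.

(* The hyperbolic space on E^n + E^n. *)
Section Hyperbolic.
Variable n : nat.
Definition hpair (v w : 'rV[E]_n) : E := \sum_i v 0 i * rho (w 0 i).
Definition hyp_val (v w : 'rV[E]_(n + n)) : E :=
  hpair (lsubmx v) (rsubmx w) + (-1) ^+ e * hpair (rsubmx v) (lsubmx w).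
Lemma hpair_linear c u v w : hpair (c *: u + v) w = c * hpair u w + hpair v w.
Proof.
rewrite /hpair mulr_sumr -big_split; apply: eq_bigr => i _ /=.
by rewrite !mxE mulrDl mulrA.
Qed.
Lemma hpair_sym v w : rho (hpair v w) = hpair w v.
Proof. by rewrite /hpair invol_sum; apply: eq_bigr => i _; rewrite involM involK. Qed.
Lemma hpair0r v : hpair v 0 = 0.
Proof. by rewrite /hpair big1 // => i _; rewrite mxE invol0 mulr0. Qed.
Lemma hpair_nondeg v : (forall w, hpair v w = 0) -> v = 0.
Proof.
move=> v0; apply/rowP => j; rewrite mxE; have := v0 (delta_mx 0 j).
rewrite /hpair (bigD1 j) //= big1 => [|i ij].
  by rewrite mxE !eqxx invol1 mulr1 addr0.
by rewrite mxE (negPf ij) andbF invol0 mulr0.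
Qed.
Fact hyp_linear c u v w : hyp_val (c *: u + v) w = c * hyp_val u w + hyp_val v w.
Proof.
by rewrite /hyp_val !linearP !hpair_linear !mulrDr sign_comm addrACA.
Qed.
Fact hyp_sym v w : hyp_val v w = (-1) ^+ e * rho (hyp_val w v).
Proof. by rewrite /hyp_val involD invol_signM !hpair_sym mulrDr signK addrC. Qed.
Fact hyp_nondeg v : (forall w, hyp_val v w = 0) -> v = 0.
Proof.
move=> v0; rewrite -[v]hsubmxK; apply/eqP; rewrite row_mx_eq0; apply/andP; split; apply/eqP.
- apply: hpair_nondeg => w; have := v0 (row_mx 0 w).
  by rewrite /hyp_val row_mxKl row_mxKr hpair0r mulr0 addr0.
- apply: hpair_nondeg => w; have := v0 (row_mx w 0).
  rewrite /hyp_val row_mxKl row_mxKr hpair0r add0r => h.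
  by rewrite -[LHS]signK h mulr0.
Qed.
Definition hyp : form := HermForm hyp_linear hyp_sym hyp_nondeg.
End Hyperbolic.

Lemma osum_isometry h h' k k' :
  isometry h h' -> isometry k k' -> isometry (osum h k) (osum h' k').
Proof.
case=> f [lf [f' fK f'K] fh] [g [lg [g' gK g'K] gh]].
exists (fun v => row_mx (f (lsubmx v)) (g (rsubmx v))); split.
- by move=> c u v; rewrite !linearP lf lg scale_row_mx add_row_mx.
- exists (fun v => row_mx (f' (lsubmx v)) (g' (rsubmx v))) => v;
  by rewrite row_mxKl row_mxKr ?fK ?gK ?f'K ?g'K hsubmxK.
- by move=> v w; rewrite /= /osum_val !row_mxKl !row_mxKr fh gh.
Qed.

Lemma osum_comm h k : isometry (osum h k) (osum k h).
Proof.
exists (fun v => row_mx (rsubmx v) (lsubmx v)); split.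
- by move=> c u v; rewrite !linearP scale_row_mx add_row_mx.
- by exists (fun v => row_mx (rsubmx v) (lsubmx v)) => v;
    rewrite row_mxKl row_mxKr hsubmxK.
- by move=> v w; rewrite /= /osum_val !row_mxKl !row_mxKr addrC.
Qed.

Lemma osum_assoc h k l : isometry (osum h (osum k l)) (osum (osum h k) l).
Proof.
exists (fun v : 'rV_(hdim h + (hdim k + hdim l)) =>
  row_mx (row_mx (lsubmx v) (lsubmx (rsubmx v))) (rsubmx (rsubmx v))).
split.
- by move=> c u v; rewrite !linearP !scale_row_mx !add_row_mx.
- by exists (fun v : 'rV_(hdim h + hdim k + hdim l) =>
    row_mx (lsubmx (lsubmx v)) (row_mx (rsubmx (lsubmx v)) (rsubmx v))) => v;
    rewrite !(row_mxKl, row_mxKr) !hsubmxK.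
- by move=> v w; rewrite /= /osum_val /= /osum_val !(row_mxKl, row_mxKr) addrA.
Qed.

Lemma osum_fzero h : isometry (osum fzero h) h.
Proof.
exists (fun v : 'rV_(0 + hdim h) => rsubmx v); split.
- by move=> c u v; rewrite linearP.
- exists (fun v : 'rV_(hdim h) => row_mx (0 : 'rV_0) v) => v; last exact: row_mxKr.
  by rewrite -[RHS]hsubmxK; congr row_mx; rewrite [RHS]thinmx0.
- by move=> v w; rewrite /= /osum_val /= add0r.
Qed.

Lemma hpair_row m n (v v' : 'rV[E]_m) (w w' : 'rV[E]_n) :
  hpair (row_mx v w) (row_mx v' w') = hpair v v' + hpair w w'.
Proof.
rewrite /hpair big_split_ord /=; congr (_ + _); apply: eq_bigr => i _.
  by rewrite !row_mxEl.
by rewrite !row_mxEr.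
Qed.

Lemma osum_hyp m n : isometry (osum (hyp m) (hyp n)) (hyp (m + n)).
Proof.
exists (fun v : 'rV_(m + m + (n + n)) =>
  row_mx (row_mx (lsubmx (lsubmx v)) (lsubmx (rsubmx v)))
         (row_mx (rsubmx (lsubmx v)) (rsubmx (rsubmx v)))).
split.
- by move=> c u v; rewrite !linearP !scale_row_mx !add_row_mx.
- by exists (fun v : 'rV_(m + n + (m + n)) =>
    row_mx (row_mx (lsubmx (lsubmx v)) (lsubmx (rsubmx v)))
           (row_mx (rsubmx (lsubmx v)) (rsubmx (rsubmx v)))) => v;
    rewrite !(row_mxKl, row_mxKr) !hsubmxK.
- move=> v w; rewrite /= /osum_val /= /hyp_val !(row_mxKl, row_mxKr) !hpair_row.
  by rewrite mulrDr addrACA.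
Qed.

Definition isometryb : rel form := fun h k => `[< isometry h k >].
Fact isometryb_equiv : equiv_class_of isometryb.
Proof.
split=> [h|h k|k h l]; first exact/asboolP/isometry_refl.
  by apply/asboolP/asboolP; apply: isometry_sym.
by move=> /asboolP hk /asboolP kl; apply/asboolP/(isometry_trans hk kl).
Qed.
Canonical isometry_equiv := EquivRelPack isometryb_equiv.
Canonical isometry_encModRel := defaultEncModRel isometryb.

(* The commutative monoid of isometry classes. *)
Definition iclass := {eq_quot isometryb}.
HB.instance Definition _ := Choice.on iclass.
HB.instance Definition _ := EqQuotient.on iclass.

Definition isom_class h : iclass := \pi_iclass h.

Lemma isom_classP h k : isom_class h = isom_class k <-> isometry h k.
Proof.
split=> [/eqP|hk]; first by rewrite piE => /asboolP.
by apply/eqP; rewrite piE; apply/asboolP.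
Qed.

Lemma isom_class_repr (x : iclass) : isom_class (repr x) = x.
Proof. exact: reprK. Qed.

Definition iclass_add (x y : iclass) := isom_class (osum (repr x) (repr y)).

Lemma isom_class_osum h k : isom_class (osum h k) = iclass_add (isom_class h) (isom_class k).
Proof.
apply/isom_classP/osum_isometry; apply/isom_classP; by rewrite isom_class_repr.
Qed.

Fact iclass_addA : associative iclass_add.
Proof.
move=> x y z; rewrite -[x]isom_class_repr -[y]isom_class_repr -[z]isom_class_repr.
by rewrite -!isom_class_osum; apply/isom_classP/osum_assoc.
Qed.
Fact iclass_addC : commutative iclass_add.
Proof. by move=> x y; apply/isom_classP/osum_comm. Qed.
Fact iclass_add0 : left_id (isom_class fzero) iclass_add.
Proof.
move=> x; rewrite -[x]isom_class_repr -isom_class_osum.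
exact/isom_classP/osum_fzero.
Qed.

HB.instance Definition _ :=
  GRing.isNmodule.Build iclass iclass_addA iclass_addC iclass_add0.

(* A pair (x, y) stands for the formal difference x - y in the Grothendieck
   group of iclass. *)
Definition witt_equiv (x y : iclass * iclass) : Prop :=
  exists m n (k : iclass),
    x.1 + y.2 + isom_class (hyp m) + k = y.1 + x.2 + isom_class (hyp n) + k.

Lemma isom_class_hyp m n :
  isom_class (hyp m) + isom_class (hyp n) = isom_class (hyp (m + n)).
Proof. by rewrite -[LHS]isom_class_osum; apply/isom_classP/osum_hyp. Qed.

Definition witt_equivb : rel (iclass * iclass) := fun x y => `[< witt_equiv x y >].

Fact witt_equivb_equiv : equiv_class_of witt_equivb.
Proof.
split=> [x|x y|y x z].
- by apply/asboolP; exists 0%N, 0%N, 0.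
- by apply/asboolP/asboolP => -[m [n [k h]]]; exists n, m, k.
move=> /asboolP[m [n [k h]]] /asboolP[m' [n' [k' h']]]; apply/asboolP.
exists (m + m')%N, (n + n')%N, (k + k' + (y.1 + y.2)); rewrite -!isom_class_hyp.
have -> : forall p q r s t u v w : iclass,
    p + q + (r + s) + (t + u + (v + w)) = (p + w + r + t) + (v + q + s + u).
  move=> p q r s t u v w; rewrite (AC (2*2*(2*2)) ((1*8*3*5)*(7*2*4*6))) //.
rewrite h h'.
by rewrite (AC (4*4) ((5*2)*(3*7)*((4*8)*(1*6)))) .
Qed.
Canonical witt_equiv_equiv := EquivRelPack witt_equivb_equiv.
Canonical witt_equiv_encModRel := defaultEncModRel witt_equivb.

(* The Witt group: the quotient of the Grothendieck group of isometry classes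
   by the subgroup generated by the hyperbolic spaces. *)
Definition witt := {eq_quot witt_equivb}.
HB.instance Definition _ := Choice.on witt.
HB.instance Definition _ := EqQuotient.on witt.

Definition witt_pair (x : iclass * iclass) : witt := \pi_witt x.

Lemma witt_pairP x y : witt_pair x = witt_pair y <-> witt_equiv x y.
Proof.
split=> [/eqP|hk]; first by rewrite piE => /asboolP.
by apply/eqP; rewrite piE; apply/asboolP.
Qed.
Lemma witt_pair_repr (x : witt) : witt_pair (repr x) = x.
Proof. exact: reprK. Qed.

Definition witt_zero : witt := witt_pair (0, 0).
Definition witt_opp (x : witt) : witt := witt_pair ((repr x).2, (repr x).1).
Definition witt_add (x y : witt) : witt :=
  witt_pair ((repr x).1 + (repr y).1, (repr x).2 + (repr y).2).

Lemma witt_pairD x y :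
  witt_add (witt_pair x) (witt_pair y) = witt_pair (x.1 + y.1, x.2 + y.2).
Proof.
apply/witt_pairP.
have /witt_pairP[m [n [k h]]] := witt_pair_repr (witt_pair x).
have /witt_pairP[m' [n' [k' h']]] := witt_pair_repr (witt_pair y).
exists (m + m')%N, (n + n')%N, (k + k'); rewrite -!isom_class_hyp /=.
rewrite (AC (2*2*2*2) ((1*3*5*7)*(2*4*6*8))) /= h h'.
by rewrite (AC (4*4) (1*5*(2*6)*(3*7)*(4*8))).
Qed.

Lemma witt_pairN x : witt_opp (witt_pair x) = witt_pair (x.2, x.1).
Proof.
apply/witt_pairP.
have /witt_pairP[m [n [k h]]] := witt_pair_repr (witt_pair x).
exists n, m, k => /=.
by rewrite [X in X + _ + _]addrC -h [X in X + _ + _ = _]addrC.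
Qed.

Fact witt_addA : associative witt_add.
Proof.
move=> x y z; rewrite -[x]witt_pair_repr -[y]witt_pair_repr -[z]witt_pair_repr.
by rewrite !witt_pairD /= !addrA.
Qed.
Fact witt_addC : commutative witt_add.
Proof. by move=> x y; rewrite /witt_add [_ + _]addrC [X in (_, X)]addrC. Qed.
Fact witt_add0 : left_id witt_zero witt_add.
Proof.
by move=> x; rewrite -[x]witt_pair_repr witt_pairD /= !add0r; case: (repr x).
Qed.
Fact witt_addN : left_inverse witt_zero witt_opp witt_add.
Proof.
move=> x; rewrite -[x]witt_pair_repr witt_pairN witt_pairD /=.
apply/witt_pairP; exists 0%N, 0%N, 0.
by rewrite /= !addr0 add0r [X in X + _]addrC.
Qed.

HB.instance Definition _ :=
  GRing.isZmodule.Build witt witt_addA witt_addC witt_add0 witt_addN.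

(* The Witt class of a form. *)
Definition witt_class h : witt := witt_pair (isom_class h, 0).

End HermitianForms.

Arguments witt {E} rho e.
Arguments witt_class {E rho e} h.
Arguments diag_form {E rho e n} u.

Section ValuedQuaternions.
Variables (K : fieldType) (nu : cdvaluation K) (a b : K).
Local Notation D := (quat a b).

(* As for [nu], only the values at nonzero elements are meaningful. *)
Definition nuD (d : D) : rat := (nu (Nrd d))%:~R / 2.
Definition OD : {pred D} := fun d => (d == 0) || (0 <= nuD d).
Definition mD : {pred D} := fun d => (d == 0) || (0 < nuD d).
Definition OD_unit (d : D) : bool :=
  [&& d \in OD, d \is a GRing.unit & d^-1 \in OD].

(* Reduction modulo mD on OD, read in (residue a, residue b / residue_field)
   through the isomorphism from OD / mD that sends the classes of 1, x, y, z to
   1, x, y, z. *)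
Definition red (d : D) : quat (residue nu a) (residue nu b) :=
  Quat _ _ (residue nu (quat1 d)) (residue nu (quatx d))
           (residue nu (quaty d)) (residue nu (quatz d)).

(* OD is a ring, and [red] identifies OD / mD with the quaternion algebra
   (residue a, residue b / residue_field). *)
Definition red_is_reduction : Prop :=
  [/\ subring_closed OD,
      [/\ red 1 = 1, {in OD &, {morph red : d d' / d + d'}}
        & {in OD &, {morph red : d d' / d * d'}}],
      {in OD, forall d, (red d == 0) = (d \in mD)}
    & forall c, exists2 d, d \in OD & red d = c].

(* [s'] is the involution induced by [s] on the residue algebra. *)
Definition induces (s : D -> D)
    (s' : quat (residue nu a) (residue nu b) -> quat (residue nu a) (residue nu b)) :=
  [/\ {in OD, forall d, s d \in OD}, {in mD, forall d, s d \in mD}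
    & {in OD, forall d, red (s d) = s' (red d)}].

Section Larmour.
Variables (sigma : involution D) (e : bool) (p : D).
Variables (s0 s1 : involution (quat (residue nu a) (residue nu b))).
Variable partial : witt sigma e -> witt s0 e * witt s1 false.

(* h is isometric to the orthogonal sum of an unramified form <u_1, ..., u_q>
   and a ramified form <v_1, ..., v_r>. *)
Definition larmour_decomposition (h : herm_form sigma e)
    q (u : 'I_q -> symunit sigma e) r (v : 'I_r -> symunit sigma e) : Prop :=
  [/\ isometry h (osum (diag_form u) (diag_form v)),
      forall i, nuD (suval (u i)) = 0
    & forall j, nuD (suval (v j)) = nuD p].

(* [partial] is Larmour's map for the e-symmetric uniformizer p, where s0 and
   s1 are induced by sigma and by its twist sigma_p. *)
Definition is_larmour : Prop :=
  forall h : herm_form sigma e,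
    (exists q (u : 'I_q -> symunit sigma e) r (v : 'I_r -> symunit sigma e),
       larmour_decomposition h u v) /\
    forall q (u : 'I_q -> symunit sigma e) r (v : 'I_r -> symunit sigma e),
      larmour_decomposition h u v ->
      exists (ubar : 'I_q -> symunit s0 e) (vbar : 'I_r -> symunit s1 false),
        [/\ forall i, suval (ubar i) = red (suval (u i)),
            forall j, suval (vbar j) = red (suval (v j) / p)
          & partial (witt_class h) =
              (witt_class (diag_form ubar), witt_class (diag_form vbar))].
End Larmour.

End ValuedQuaternions.

(* The one-dimensional form <u>. *)
Definition diag1 (E : unitRingType) (rho : involution E) (e : bool)
  (u : symunit rho e) : herm_form rho e := diag_form (fun _ : 'I_1 => u).

(* Main.v *)
From HB Require Import structures.
Require Import Defs.
From mathcomp Require Import all_boot all_order all_algebra.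
From mathcomp Require Import generic_quotient boolp ring zify.

Set Implicit Arguments.
Unset Strict Implicit.
Unset Printing Implicit Defensive.

Import Order.TTheory GRing.Theory Num.Theory.
Local Open Scope ring_scope.
Local Open Scope quotient_scope.

(** The idea is to describe homomorphisms out of a Witt group by generators
    and relations, so that neither Witt cancellation nor anisotropic kernels
    are ever needed.

    Over a division ring with involution in which 2 is invertible, any two
    orthogonal bases of a hermitian space are connected by elementary moves:
    permuting the basis, rescaling one vector, and replacing an orthogonal pair
    v, w by v + w and the vector of the same plane orthogonal to it
    ([chain_exchange], [diag_sum_span]).  On values the moves read
    <u> = <c u c*> and <u> + <v> = <u + v> + <u^-1 + v^-1>.  Together with
    <u> + <-u> = 0, which kills the hyperbolic plane, these relations present
    the Witt group: a function on symmetric units that satisfies them extends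
    to the Witt group ([witt_lift]), uniquely ([witt_additive_ext]).

    Every nonzero d in D is pi^k d0 with k = nu_D(d) and with d0 of nonzero
    reduction, because the reduced norm of the residue algebra is anisotropic:
    a zero would lift to a zero of the norm of D, since 1-units of K are squares
    ([sqrt_one_unit], [Nrd_primitive]).  Larmour's map sends <d> to the class of
    <red d0>, in the first component if k is even and in the second if k is
    odd; a short case distinction on valuations shows that it respects the
    relations ([residue_class_invariant]).

    The inverse lifts <e> to <u> and to <pi u>, where u is a symmetric lift of e.
    The choice of u is irrelevant: if u and v are symmetric with the same
    valuation and the same leading coefficient, then u^-1 v = m^2 with m a
    K-linear combination of u^-1 v and 1, hence v = m* u m ([hermitian_lift]).
    For the same reason the lifts respect the relations
    ([lift_class_invariant]), and the two maps are mutually inverse because they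
    are so on generators ([partial_bijective]). *)

Local Notation isometry := Defs.isometry.

(** * Spans *)

Section Span.
Variables (E : nzRingType) (V : lmodType E).
Implicit Types (B : seq V) (v w : V).

Inductive span B : V -> Prop :=
| span0 : span B 0
| spanZD c b v : b \in B -> span B v -> span B (c *: b + v).

Lemma spanD B v w : span B v -> span B w -> span B (v + w).
Proof.
elim=> [|c b u bB _ IH] hw; first by rewrite add0r.
by rewrite -addrA; apply: spanZD => //; apply: IH.
Qed.

Lemma spanZ B c v : span B v -> span B (c *: v).
Proof.
elim=> [|d b u bB _ IH]; first by rewrite scaler0; apply: span0.
by rewrite scalerDr scalerA; apply: spanZD.
Qed.

Lemma spanB B v w : span B v -> span B w -> span B (v - w).
Proof. by move=> hv hw; rewrite -scaleN1r; apply: spanD => //; apply: spanZ. Qed.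

Lemma span_mem B b : b \in B -> span B b.
Proof. by move=> bB; rewrite -[b]scale1r -[_ *: _]addr0; apply: spanZD => //; apply: span0. Qed.

Lemma span_sub B B' : {in B, forall b, span B' b} -> forall v, span B v -> span B' v.
Proof.
move=> hB v; elim=> [|c b u bB _ IH]; first exact: span0.
by apply: spanD => //; apply: spanZ; apply: hB.
Qed.

Lemma span_consP b B v :
  span (b :: B) v -> exists c w, span B w /\ v = c *: b + w.
Proof.
elim=> [|c b' u]; first by exists 0, 0; split; [apply: span0 | rewrite scale0r addr0].
rewrite inE => /orP[/eqP->|b'B] _ [d [w [hw ->]]].
  by exists (c + d), w; rewrite scalerDl addrA.
by exists d, (c *: b' + w); split; [apply: spanZD | rewrite addrCA].
Qed.

Lemma span_nil v : span [::] v -> v = 0.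
Proof. by case. Qed.

Definition same_span B B' := forall v, span B v <-> span B' v.

Lemma same_span_sub B B' :
  {in B, forall b, span B' b} -> {in B', forall b, span B b} -> same_span B B'.
Proof. by move=> h h' v; split; apply: span_sub. Qed.

Lemma span_cons b B v : span B v -> span (b :: B) v.
Proof. by apply: span_sub => c cB; apply: span_mem; rewrite inE cB orbT. Qed.

Lemma same_span_cons b B B' : same_span B B' -> same_span (b :: B) (b :: B').
Proof.
move=> sBB; apply: same_span_sub => c; rewrite inE => /orP[/eqP->|cB].
- by apply: span_mem; rewrite inE eqxx.
- by apply: span_cons; apply/sBB/span_mem.
- by apply: span_mem; rewrite inE eqxx.
- by apply: span_cons; apply/sBB/span_mem.
Qed.

End Span.

(** * Orthogonal families *)

Section FormTheory.
Variables (E : unitRingType) (rho : involution E).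
Implicit Type h : herm_form rho false.

Lemma hformC h v w : h v w = rho (h w v).
Proof. by rewrite {1}hform_sym expr0 mul1r. Qed.
Lemma hformDl h u v w : h (u + v) w = h u w + h v w.
Proof. by have := @hform_linear _ _ _ h 1 u v w; rewrite scale1r mul1r. Qed.
Lemma hformZl h c u w : h (c *: u) w = c * h u w.
Proof. by have := @hform_linear _ _ _ h c u 0 w; rewrite addr0 hform0l addr0. Qed.
Lemma hformDr h u v w : h w (u + v) = h w u + h w v.
Proof. by rewrite hformC hformDl involD -!hformC. Qed.
Lemma hformZr h c u w : h w (c *: u) = h w u * rho c.
Proof. by rewrite hformC hformZl involM -hformC. Qed.
Lemma hformNl h u w : h (- u) w = - h u w.
Proof. by rewrite -scaleN1r hformZl mulN1r. Qed.
Lemma hformNr h u w : h w (- u) = - h w u.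
Proof. by rewrite hformC hformNl involN -hformC. Qed.
Lemma hform_suml h I (r : seq I) (P : pred I) (F : I -> 'rV[E]_(hdim h)) w :
  h (\sum_(i <- r | P i) F i) w = \sum_(i <- r | P i) h (F i) w.
Proof. exact: (big_morph (fun u => h u w) (fun u v => hformDl u v w) (hform0l w)). Qed.
Lemma hform_sumr h I (r : seq I) (P : pred I) (F : I -> 'rV[E]_(hdim h)) w :
  h w (\sum_(i <- r | P i) F i) = \sum_(i <- r | P i) h w (F i).
Proof. exact: (big_morph (h w) (fun u v => hformDr u v w) (hform0r w)). Qed.
Lemma hform_orthC h v w : h v w = 0 -> h w v = 0.
Proof. by move=> vw; rewrite hformC vw invol0. Qed.
Lemma hform_diag_sym h v : rho (h v v) = h v v.
Proof. by rewrite -hformC. Qed.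

Lemma hform_span_orth h B w :
  {in B, forall b, h b w = 0} -> forall v, span B v -> h v w = 0.
Proof.
move=> hB v; elim=> [|c b u bB _ IH]; first exact: hform0l.
by rewrite hformDl hformZl hB // IH mulr0 addr0.
Qed.

Definition orth h (B : seq 'rV[E]_(hdim h)) :=
  all (fun b => h b b != 0) B && pairwise (fun b c => h b c == 0) B.

Definition orth_basis h (B : seq 'rV[E]_(hdim h)) :=
  orth B /\ forall v, span B v.

Lemma orth_cons h (b : 'rV[E]_(hdim h)) B :
  orth (b :: B) <-> [/\ h b b != 0, {in B, forall c, h b c = 0} & orth B].
Proof.
rewrite /orth /=; split.
  case/andP=> /andP[hb hB] /andP[/allP hbB pB]; split=> //; last by rewrite hB.
  by move=> c /hbB/eqP.
case=> hb hbB /andP[hB pB]; rewrite hb hB pB !andbT /=.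
by apply/allP => c /hbB/eqP.
Qed.

Lemma orth_cat h (B C : seq 'rV[E]_(hdim h)) :
  orth (B ++ C) <-> [/\ orth B, orth C & {in B & C, forall b c, h b c = 0}].
Proof.
rewrite /orth all_cat pairwise_cat; split.
  case/andP=> /andP[-> ->] /and3P[/allrelP hBC -> ->]; split=> // b c bB cC.
  exact/eqP/hBC.
case=> /andP[-> ->] /andP[-> ->] hBC; rewrite /= andbT.
by apply/allrelP => b c bB cC; apply/eqP/hBC.
Qed.

Lemma orth_perm h (B B' : seq 'rV[E]_(hdim h)) : perm_eq B B' -> orth B -> orth B'.
Proof.
move: B B'; apply: catCA_perm_ind => B1 B2 B3.
case/orth_cat=> o1 /orth_cat[o2 o3 h23] h1; apply/orth_cat; split=> //.
  apply/orth_cat; split=> // b c bB cB; apply: h1 => //; by rewrite mem_cat cB orbT.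
move=> b c bB; rewrite mem_cat => /orP[cB|]; last exact: h23.
  by apply: hform_orthC; apply: h1 => //; rewrite mem_cat bB.
Qed.

End FormTheory.

Arguments orth_basis {E rho} h B.

(** * Chain equivalence of orthogonal bases *)

Section ChainEquivalence.
Variables (E : unitRingType) (rho : involution E).
Hypotheses (divE : is_division E) (two_neq0 : (2 : E) != 0).

(** The defining relations of the Witt group on the generators <u>.  The second
    one compares two orthogonal bases of the plane <u, v>: the vector orthogonal
    to e1 + e2 is u^-1 e1 - v^-1 e2, of norm u^-1 + v^-1. *)
Record diagonal_invariant (G : zmodType) (f : E -> G) : Prop := DiagonalInvariant {
  dinv_congr : forall c u, c != 0 -> u != 0 -> rho u = u -> f (c * u * rho c) = f u;
  dinv_binary : forall u v, u != 0 -> v != 0 -> rho u = u -> rho v = v ->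
    u + v != 0 -> f u + f v = f (u + v) + f (u^-1 + v^-1);
  dinv_opp : forall u, u != 0 -> rho u = u -> f u + f (- u) = 0
}.

Variables (G : zmodType) (f : E -> G) (finv : diagonal_invariant f).
Variable h : herm_form rho false.
Local Notation V := 'rV[E]_(hdim h).
Implicit Types (B : seq V) (v w s : V).

Definition diag_sum B := \sum_(b <- B) f (h b b).

Lemma mulf_divneq0 (c d : E) : c != 0 -> d != 0 -> c * d != 0.
Proof.
by move=> /divE cU d0; apply: contra_neq d0 => cd; rewrite -[d](mulKr cU) cd mulr0.
Qed.

Lemma invr_neq0_div (c : E) : c != 0 -> c^-1 != 0.
Proof. by apply: contra_neq => c0; rewrite -[c]invrK c0 invr0. Qed.

Lemma invr_add (c d : E) : c != 0 -> d != 0 -> c^-1 + d^-1 = c^-1 * (c + d) * d^-1.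
Proof.
move=> /divE cU /divE dU.
by rewrite mulrDr mulVr // mulrDl mul1r mulrK // addrC.
Qed.

Lemma invr_add_neq0 (c d : E) : c != 0 -> d != 0 -> c + d != 0 -> c^-1 + d^-1 != 0.
Proof. by move=> c0 d0 cd; rewrite invr_add // !mulf_divneq0 // invr_neq0_div. Qed.

Lemma invol_neq0 (c : E) : c != 0 -> rho c != 0.
Proof. by apply: contra_neq => c0; rewrite -[c](involK rho) c0 invol0. Qed.

Lemma normZ c v : h (c *: v) (c *: v) = c * h v v * rho c.
Proof. by rewrite hformZl hformZr mulrA. Qed.

Lemma normD v w : h v w = 0 -> h (v + w) (v + w) = h v v + h w w.
Proof.
by move=> vw; rewrite hformDl !hformDr vw (hform_orthC vw) addr0 add0r.
Qed.

(** The orthogonality of B is a premise, so that the moves below can be composed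
    without carrying it along. *)
Definition chain_equiv B B' :=
  orth B -> [/\ orth B', same_span B B' & diag_sum B = diag_sum B'].

Lemma chain_trans B1 B2 B3 : chain_equiv B1 B2 -> chain_equiv B2 B3 -> chain_equiv B1 B3.
Proof.
move=> h12 h23 /h12[/h23[o3 s23 d23] s12 d12]; split=> //; last by rewrite d12.
by move=> v; split=> [/s12/s23|/s23/s12].
Qed.

Lemma chain_perm B B' : perm_eq B B' -> chain_equiv B B'.
Proof.
move=> pBB oB; split; first exact: orth_perm oB.
  apply: same_span_sub => b bB; apply: span_mem; first by rewrite -(perm_mem pBB).
  by rewrite (perm_mem pBB).
exact: perm_big.
Qed.

Lemma chain_swap v w B : chain_equiv (v :: w :: B) (w :: v :: B).
Proof. by apply: chain_perm; apply: permEl (perm_catCA [:: v] [:: w] B). Qed.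

Lemma chain_cons b B B' : chain_equiv B B' -> chain_equiv (b :: B) (b :: B').
Proof.
move=> hBB /orth_cons[hb hbB /hBB[oB' sBB dBB]]; split.
- apply/orth_cons; split=> // c /span_mem/sBB cB; apply: hform_orthC.
  by apply: hform_span_orth cB => d /hbB; apply: hform_orthC.
- exact: same_span_cons.
- by rewrite /diag_sum !big_cons; congr (_ + _).
Qed.

Lemma chain_scale c b B : c != 0 -> chain_equiv (b :: B) (c *: b :: B).
Proof.
move=> c0 /orth_cons[hb hbB oB]; split.
- apply/orth_cons; rewrite normZ; split=> //.
    by rewrite !mulf_divneq0 // invol_neq0.
  by move=> d dB; rewrite hformZl hbB // mulr0.
- apply: same_span_sub => d; rewrite inE => /orP[/eqP->|dB].
  + rewrite -[b in span _ b]scale1r -(mulVr (divE c0)) -scalerA.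
    by apply: spanZ; apply: span_mem; rewrite inE eqxx.
  + by apply: span_cons; apply: span_mem.
  + by apply: spanZ; apply: span_mem; rewrite inE eqxx.
  + by apply: span_cons; apply: span_mem.
- by rewrite /diag_sum !big_cons normZ dinv_congr // hform_diag_sym.
Qed.

Lemma chain_binary v w B : h (v + w) (v + w) != 0 ->
  chain_equiv (v :: w :: B)
    (v + w :: (h v v)^-1 *: v - (h w w)^-1 *: w :: B).
Proof.
move=> hvw /orth_cons[hv hvB /orth_cons[hw hwB oB]].
have vw : h v w = 0 by apply: hvB; rewrite inE eqxx.
have wv := hform_orthC vw.
have vU := divE hv; have wU := divE hw.
have rV u : h u u != 0 -> rho (h u u)^-1 = (h u u)^-1.
  by move=> /divE uU; rewrite involV // hform_diag_sym.
set t := _ - _.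
have ht : h t t = (h v v)^-1 + (h w w)^-1.
  rewrite /t -scaleNr normD; last by rewrite hformZl hformZr vw mul0r mulr0.
  by rewrite !normZ involN !rV // mulNr mulrNN !mulVr // !mul1r.
have hst : h (v + w) t = 0.
  rewrite /t hformDl !hformDr !hformNr !hformZr vw wv !rV // !divrr // !mul0r.
  by rewrite oppr0 addr0 add0r subrr.
have hvw' : h v v + h w w != 0 by rewrite -normD.
have ht0 : h t t != 0.
  by rewrite ht invr_add_neq0.
split.
- apply/orth_cons; split=> //.
    move=> c; rewrite inE => /orP[/eqP->//|cB].
    by rewrite hformDl hvB ?hwB ?addr0 // inE cB orbT.
  apply/orth_cons; split=> // c cB.
  have hvc : h v c = 0 by apply: hvB; rewrite inE cB orbT.
  by rewrite /t hformDl hformNl !hformZl hvc (hwB c cB) !mulr0 subrr.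
- have m1 c (C : seq V) : span (c :: C) c by apply: span_mem; rewrite inE eqxx.
  have m2 c d (C : seq V) : span (c :: d :: C) d by apply: span_cons.
  have m3 c d e (C : seq V) : e \in C -> span (c :: d :: C) e.
    by move=> eC; do 2!apply: span_cons; apply: span_mem.
  have sv : span (v + w :: t :: B) v.
    have e : (h w w)^-1 *: (v + w) + t = h t t *: v.
      by rewrite ht scalerDl /t scalerDr addrACA addrN addr0 addrC.
    rewrite -[v in span _ v]scale1r -(mulVr (divE ht0)) -scalerA -e.
    by apply: spanZ; apply: spanD => //; apply: spanZ.
  have sw : span (v + w :: t :: B) w.
    by rewrite -[w in span _ w](addKr v) [- v + _]addrC; apply: spanB.
  apply: same_span_sub => c; rewrite !inE => /or3P[/eqP->|/eqP->|cB] //.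
  + exact: m3.
  + exact: spanD.
  + by apply: spanB; apply: spanZ.
  + exact: m3.
- rewrite /diag_sum !big_cons !addrA; congr (_ + _).
  by rewrite ht normD // dinv_binary // hform_diag_sym.
Qed.

Lemma double_neq0 (d : E) : d != 0 -> d + d != 0.
Proof. by move=> d0; rewrite -mulr2n -mulr_natl mulf_divneq0. Qed.

(** The two vectors w1, w2 are added to v one at a time.  This fails in one order
    only if v + w1 is isotropic; since the norms of w1 and w2 are opposite, v + w2
    is then anisotropic, 2 being invertible, and the other order works. *)
Lemma chain_isotropic_ternary v w1 w2 B : h (w1 + w2) (w1 + w2) = 0 -> h v v != 0 ->
  exists B', chain_equiv (v :: w1 :: w2 :: B) (v + (w1 + w2) :: B').
Proof.
move=> hw hv; pose C := v :: w1 :: w2 :: B.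
have [oC|/negP nC] := boolP (orth C); last by exists [::] => oC; case: nC.
have /orth_cons[_ hvC /orth_cons[hw1 hw1C /orth_cons[hw2 _ _]]] := oC.
have vw1 : h v w1 = 0 by apply: hvC; rewrite inE eqxx.
have vw2 : h v w2 = 0 by apply: hvC; rewrite !inE eqxx orbT.
have w12 : h w1 w2 = 0 by apply: hw1C; rewrite inE eqxx.
have hs : h (v + (w1 + w2)) (v + (w1 + w2)) != 0.
  by rewrite normD ?hw ?addr0 // hformDr vw1 vw2 addr0.
have step u1 u2 : h v u1 = 0 -> h v u2 = 0 -> h (v + u1) (v + u1) != 0 ->
    h (v + u1 + u2) (v + u1 + u2) != 0 ->
    exists B', chain_equiv (v :: u1 :: u2 :: B) (v + u1 + u2 :: B').
  move=> vu1 vu2 h1 h2; pose r := (h v v)^-1 *: v - (h u1 u1)^-1 *: u1.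
  eexists; apply: (chain_trans (chain_binary h1)).
  apply: (@chain_trans _ (v + u1 :: u2 :: r :: B)); last exact: chain_binary.
  exact (chain_cons (chain_swap (B := B))).
have [h1|h1] := boolP (h (v + w1) (v + w1) != 0).
  by rewrite addrA; apply: step => //; rewrite -addrA.
have h2 : h (v + w2) (v + w2) != 0.
  rewrite normD //; move: h1; rewrite negbK normD // addr_eq0 => /eqP->.
  move: hw; rewrite normD // => /eqP; rewrite addr_eq0 => /eqP ->.
  by rewrite opprK double_neq0.
have [B' hB'] : exists B', chain_equiv (v :: w2 :: w1 :: B) (v + w2 + w1 :: B').
  by apply: step => //; rewrite -addrA [w2 + _]addrC.
exists B'; rewrite [w1 + w2]addrC addrA; apply: chain_trans hB'.
exact: (chain_cons (chain_swap (B := B))).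
Qed.

(** Any anisotropic vector of the span can be made the first member of an
    orthogonal family, without changing the span or the sum of values.  The
    induction adds the first basis vector to a combination s0 of the others, and
    s0 may be isotropic; this is why the statement also handles isotropic
    vectors, which become the sum of the first two members. *)
Lemma chain_exchange B : orth B -> forall s, span B s ->
  (h s s != 0 -> exists B', chain_equiv B (s :: B')) /\
  (s != 0 -> h s s = 0 ->
     exists t1 t2 B', chain_equiv B (t1 :: t2 :: B') /\ s = t1 + t2).
Proof.
elim: B => [_ s /span_nil->|b B IH /orth_cons[hb hbB oB] s /span_consP[c [s0 [s0B ->]]]].
  by rewrite hform0l eqxx; split=> [/negP|/negP]; case.
have [IHA IHB] := IH oB s0 s0B.
have bs0 : h b s0 = 0.
  by apply: hform_orthC; apply: hform_span_orth s0B => d /hbB; apply: hform_orthC.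
have [->|c0] := eqVneq c 0.
  rewrite scale0r add0r; split=> [/IHA[B' hB']|/IHB h1 /h1[t1 [t2 [B' [hB' ->]]]]].
    exists (b :: B'); apply: (@chain_trans _ (b :: s0 :: B')); first exact: chain_cons.
    exact: (chain_swap (B := B')).
  exists t1, t2, (b :: B'); split=> //.
  apply: (@chain_trans _ (b :: t1 :: t2 :: B')); first exact: chain_cons.
  apply: (@chain_trans _ (t1 :: b :: t2 :: B')).
    exact: (chain_swap (B := t2 :: B')).
  exact: chain_cons (chain_swap (B := B')).
have cbs0 : h (c *: b) s0 = 0 by rewrite hformZl bs0 mulr0.
have hcb : h (c *: b) (c *: b) != 0 by rewrite normZ !mulf_divneq0 // invol_neq0.
split=> [hs|s_neq0].
- have [s00|s00] := eqVneq s0 0; first by exists B; rewrite s00 addr0; apply: chain_scale.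
  have [hs0|hs0] := eqVneq (h s0 s0) 0; last first.
    have [B' hB'] := IHA hs0; eexists.
    apply: (chain_trans (chain_scale c0)).
    by apply: (chain_trans (chain_cons hB')); apply: chain_binary.
  have [t1 [t2 [B' [hB' s0E]]]] := IHB s00 hs0; rewrite s0E in hs0 *.
  have [B'' hB''] := chain_isotropic_ternary B' hs0 hcb.
  exists B''; apply: (chain_trans (chain_scale c0)).
  exact: chain_trans (chain_cons hB') hB''.
- rewrite normD // => /eqP; rewrite addrC addr_eq0 => /eqP hs0.
  have /IHA[B' hB'] : h s0 s0 != 0 by rewrite hs0 oppr_eq0.
  exists (c *: b), s0, B'; split=> //.
  exact: chain_trans (chain_scale c0) (chain_cons hB').
Qed.

(** Make the first vector of B' the first member of both families.  The remaining
    members then span the orthogonal complement of that vector in the common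
    span, so the induction goes on. *)
Theorem diag_sum_span B B' :
  orth B -> orth B' -> same_span B B' -> diag_sum B = diag_sum B'.
Proof.
elim: B' B => [|s B' IH] B oB.
  move=> _ sB; case: B oB sB => [//|b B] /orth_cons[hb _ _] sB.
  have /sB/span_nil b0 : span (b :: B) b by apply: span_mem; rewrite inE eqxx.
  by rewrite b0 hform0l eqxx in hb.
move=> /orth_cons[hs hsB' oB'] sB.
have sBs : span B s by apply/sB/span_mem; rewrite inE eqxx.
have [/(_ hs)[B1 /(_ oB)[/orth_cons[_ hsB1 oB1] sBB1 ->]] _] := chain_exchange oB sBs.
rewrite /diag_sum !big_cons; congr (_ + _); apply: IH => //.
have sub C C' : {in C, forall c, h s c = 0} -> {in C', forall c, h s c = 0} ->
    (forall v, span (s :: C) v -> span (s :: C') v) -> forall v, span C v -> span C' v.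
  move=> hC hC' sCC' v vC; have [c [w [wC' vE]]] := span_consP (sCC' v (span_cons s vC)).
  have orthspan D x : {in D, forall c, h s c = 0} -> span D x -> h x s = 0.
    by move=> hD; apply: hform_span_orth => d /hD; apply: hform_orthC.
  have := orthspan _ _ hC vC; rewrite vE hformDl hformZl (orthspan _ _ hC' wC') addr0.
  have [->|c0] := eqVneq c 0; first by rewrite scale0r add0r.
  by move/eqP; rewrite (negPf (mulf_divneq0 c0 hs)).
move=> v; split; apply: sub => // u; first by move/sBB1/sB.
by move/sB/sBB1.
Qed.

End ChainEquivalence.

(** * Diagonalization *)

Section OrthogonalBases.
Variables (E : unitRingType) (rho : involution E).
Hypotheses (divE : is_division E) (two_neq0 : (2 : E) != 0).
Implicit Types h k : herm_form rho false.

Lemma orth_nth h (B : seq 'rV[E]_(hdim h)) i j :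
  orth B -> (i < size B)%N -> (j < size B)%N -> i != j -> h B`_i B`_j = 0.
Proof.
case/andP=> _ /(pairwiseP 0) pB iB jB; rewrite neq_ltn => /orP[ij|ji].
  exact/eqP/pB.
by apply: hform_orthC; apply/eqP/pB.
Qed.

Lemma orth_basis_isometry h (B : seq 'rV[E]_(hdim h)) n
    (u : 'I_n -> symunit rho false) :
  size B = n -> orth_basis h B -> (forall i, suval (u i) = h B`_i B`_i) ->
  isometry (diag_form u) h.
Proof.
move=> nE [oB sB]; case: n / nE u => u uE.
have hB (i j : 'I_(size B)) : h B`_i B`_j = if i == j then suval (u i) else 0.
  case: eqVneq => [<-|ij]; first by rewrite uE.
  by apply: orth_nth; rewrite ?ltn_ord.
have uU i : suval (u i) \is a GRing.unit by case/andP: (suP (u i)).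
pose F (v : 'rV[E]_(size B)) := \sum_(i < size B) v 0 i *: B`_i.
pose H (w : 'rV[E]_(hdim h)) := \row_(i < size B) (h w B`_i * (suval (u i))^-1).
have hF v (i : 'I_(size B)) : h (F v) B`_i = v 0 i * suval (u i).
  rewrite /F hform_suml (bigD1 i) //= big1 => [|j ji].
    by rewrite addr0 hformZl hB eqxx.
  by rewrite hformZl hB (negPf ji) mulr0.
exists F; split.
- move=> c v w; rewrite /F scaler_sumr -big_split; apply: eq_bigr => i _ /=.
  by rewrite !mxE scalerDl scalerA.
- exists H => w; first by apply/rowP => i; rewrite mxE hF mulrK.
  apply/eqP; rewrite -subr_eq0; apply/eqP; apply: hform_nondeg => x.
  apply: hform_orthC; apply: hform_span_orth (sB x) => b /(nthP 0)[i iB <-].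
  apply: hform_orthC; rewrite hformDl hformNl (hF (H w) (Ordinal iB)) mxE.
  by rewrite mulrVK // subrr.
- move=> v w; rewrite /= /diag_val [F w]/F hform_sumr; apply: eq_bigr => i _.
  by rewrite hformZr hF.
Qed.

(** Induction on the number of generators: unless the form vanishes on S, some x or
    x + c y is anisotropic, it can replace a generator, and the other
    generators are projected onto its orthogonal complement.  R spans the
    radical of the restriction of h to the span of S. *)
Lemma gram_schmidt h (S : seq 'rV[E]_(hdim h)) : exists B R,
  [/\ orth B, same_span S (B ++ R), {in B & R, forall b r, h b r = 0}
    & {in R &, forall r r', h r r' = 0}].
Proof.
have [n] := ubnP (size S); elim: n S => // n IH S szS.
have [/allrelP S0|] := boolP (allrel (fun x y => h x y == 0) S S).
  by exists [::], S; split=> // x y xS yS; apply/eqP/S0.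
rewrite -has_predC => /hasP[x xS]; rewrite /= -has_predC => /hasP[y yS /= hxy].
have [v [z [zS vS zv hv]]] : exists v z, [/\ z \in S, span S v,
    span (v :: rem z S) z & h v v != 0].
  have [hx|hx] := eqVneq (h x x) 0; last first.
    exists x, x; split=> //; first exact: span_mem.
    by apply: span_mem; rewrite inE eqxx.
  have [hy|hy] := eqVneq (h y y) 0; last first.
    exists y, y; split=> //; first exact: span_mem.
    by apply: span_mem; rewrite inE eqxx.
  have yx : y != x by apply: contra_neq hxy => ->.
  have hyx : h y x != 0 by apply: contra_neq hxy; apply: hform_orthC.
  exists (x + (h y x)^-1 *: y), x; split=> //.
  - by apply: spanD; [|apply: spanZ]; apply: span_mem.
  - rewrite -[x in span _ x](addrK ((h y x)^-1 *: y)); apply: spanB.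
      by apply: span_mem; rewrite inE eqxx.
    apply: spanZ; apply: span_mem; rewrite inE; apply/orP; right.
    by move: yS; rewrite (perm_mem (perm_to_rem xS)) inE (negPf yx).
  - rewrite hformDl !hformDr hx add0r !hformZl !hformZr hy mul0r mulr0 addr0.
    by rewrite mulVr ?divE // hformC -involM mulVr ?divE // invol1.
pose P w := w - h w v * (h v v)^-1 *: v.
have Pv w : h (P w) v = 0 by rewrite hformDl hformNl hformZl mulrVK ?subrr ?divE.
have [|B [R [oB sBR hBR hR]]] := IH [seq P w | w <- rem z S].
  by rewrite size_map size_rem //; case: (S) zS szS.
have vP w : w \in B ++ R -> h v w = 0.
  move=> /span_mem/sBR wS; apply: hform_orthC; apply: hform_span_orth wS => _ /mapP[c _ ->].
  exact: Pv.
exists (v :: B), R; split=> //.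
- by apply/orth_cons; split=> // c cB; apply: vP; rewrite mem_cat cB.
- have sP w : w \in rem z S -> span (v :: B ++ R) w.
    move=> wS; rewrite -[w](subrK (h w v * (h v v)^-1 *: v)); apply: spanD.
      by apply: span_cons; apply/sBR/span_mem/map_f.
    by apply: spanZ; apply: span_mem; rewrite inE eqxx.
  have sz : same_span S (v :: rem z S).
    apply: same_span_sub => w.
      rewrite (perm_mem (perm_to_rem zS)) inE => /orP[/eqP->//|wS].
      by apply: span_cons; apply: span_mem.
    rewrite inE => /orP[/eqP->//|wS]; apply: span_mem.
    by rewrite (perm_mem (perm_to_rem zS)) inE wS orbT.
  have sz' : same_span (v :: rem z S) (v :: B ++ R).
    apply: same_span_sub => w; rewrite inE => /orP[/eqP->|wS].
    + by apply: span_mem; rewrite inE eqxx.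
    + exact: sP.
    + by apply: span_mem; rewrite inE eqxx.
    + move/span_mem/sBR: wS; apply: span_sub => _ /mapP[c cS ->].
      apply: spanB; first by apply: span_cons; apply: span_mem.
      by apply: spanZ; apply: span_mem; rewrite inE eqxx.
  by move=> w; split=> [/sz/sz'|/sz'/sz].
- by move=> b r; rewrite inE => /orP[/eqP->|bB] rR; [apply: vP; rewrite mem_cat rR orbT|apply: hBR].
Qed.

Lemma span_std n (v : 'rV[E]_n) : span [seq delta_mx 0 i | i <- enum 'I_n] v.
Proof.
rewrite [v]matrix_sum_delta big_ord1.
elim/big_ind: _ => [|x y|i _]; [exact: span0|exact: spanD|].
by apply: spanZ; apply: span_mem; apply: map_f; rewrite mem_enum.
Qed.

Lemma orth_basis_ex h : exists B, orth_basis h B.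
Proof.
have [B [R [oB sBR hBR hR]]] :=
  gram_schmidt (h := h) [seq delta_mx 0 i | i <- enum 'I_(hdim h)].
exists B; split=> // v.
have R0 r : r \in R -> r = 0.
  move=> rR; apply: hform_nondeg => w; apply: hform_orthC.
  have /sBR := span_std w; apply: hform_span_orth => b; rewrite mem_cat => /orP[bB|bR].
    exact: hBR.
  exact: hR.
have /sBR := span_std v; apply: span_sub => b; rewrite mem_cat => /orP[|/R0->].
  exact: span_mem.
exact: span0.
Qed.

Lemma diag_osum m n (u : 'I_(m + n) -> symunit rho false) :
  isometry (diag_form u)
    (osum (diag_form (fun i => u (lshift n i))) (diag_form (fun i => u (rshift m i)))).
Proof.
exists id; split=> //; first by exists id.
move=> v w; rewrite /= /osum_val /= /diag_val big_split_ord /=.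
by congr (_ + _); apply: eq_bigr => i _; rewrite !mxE.
Qed.

Lemma orth_basis_transport h k (F : 'rV[E]_(hdim h) -> 'rV[E]_(hdim k)) B :
  (forall c u v, F (c *: u + v) = c *: F u + F v) -> bijective F ->
  (forall v w, k (F v) (F w) = h v w) ->
  orth_basis h B -> orth_basis k (map F B).
Proof.
move=> linF [F' FK F'K] hF [oB sB]; split.
  move: oB; rewrite /orth all_map pairwise_map => /andP[/allP aB pB].
  apply/andP; split; first by apply/allP => b /aB /=; rewrite hF.
  by apply: sub_pairwise pB => b c /=; rewrite hF.
move=> w; rewrite -[w]F'K; elim: (sB (F' w)) => [|c b v bB _ IH].
  have -> : F 0 = 0; last exact: span0.
  by have := linF (-1) 0 0; rewrite scaler0 addr0 scaleN1r addNr.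
by rewrite linF; apply: spanZD => //; apply: map_f.
Qed.

Lemma orth_basis_osum h k (B : seq 'rV[E]_(hdim h)) (C : seq 'rV[E]_(hdim k)) :
  orth_basis h B -> orth_basis k C ->
  orth_basis (osum h k)
    ([seq row_mx b 0 | b <- B] ++ [seq row_mx 0 c | c <- C]).
Proof.
move=> [oB sB] [oC sC]; split.
  apply/orth_cat; split.
  - move: oB; rewrite /orth all_map pairwise_map => /andP[/allP aB pB].
    apply/andP; split.
      by apply/allP => b /aB /=; rewrite /osum_val !row_mxKl !row_mxKr hform0l addr0.
    apply: sub_pairwise pB => b c /=.
    by rewrite /osum_val !row_mxKl !row_mxKr hform0l addr0.
  - move: oC; rewrite /orth all_map pairwise_map => /andP[/allP aC pC].
    apply/andP; split.
      by apply/allP => b /aC /=; rewrite /osum_val !row_mxKl !row_mxKr hform0l add0r.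
    apply: sub_pairwise pC => b c /=.
    by rewrite /osum_val !row_mxKl !row_mxKr hform0l add0r.
  - move=> _ _ /mapP[b _ ->] /mapP[c _ ->] /=.
    by rewrite /osum_val !row_mxKl !row_mxKr hform0l hform0r addr0.
move=> /= w; rewrite -[w]hsubmxK -[lsubmx w]addr0 -[rsubmx w]add0r -add_row_mx.
apply: spanD.
  apply: (@span_sub _ _ [seq row_mx b 0 | b <- B]).
    by move=> b bB; apply: span_mem; rewrite mem_cat bB.
  elim: (sB (lsubmx w)) => [|c b v bB _ IH]; first by rewrite row_mx0; apply: span0.
  have -> : row_mx (c *: b + v) (0 : 'rV_(hdim k)) = c *: row_mx b 0 + row_mx v 0.
    by rewrite scale_row_mx add_row_mx scaler0 addr0.
  by apply: spanZD => //; apply: map_f.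
apply: (@span_sub _ _ [seq row_mx 0 c | c <- C]).
  by move=> b bB; apply: span_mem; rewrite mem_cat bB orbT.
elim: (sC (rsubmx w)) => [|c b v bB _ IH]; first by rewrite row_mx0; apply: span0.
have -> : row_mx (0 : 'rV_(hdim h)) (c *: b + v) = c *: row_mx 0 b + row_mx 0 v.
  by rewrite scale_row_mx add_row_mx scaler0 addr0.
by apply: spanZD => //; apply: map_f.
Qed.

Lemma orth_basis_scale h (B : seq 'rV[E]_(hdim h)) (c : 'rV[E]_(hdim h) -> E) :
  (forall v, c v != 0) -> orth_basis h B -> orth_basis h [seq c b *: b | b <- B].
Proof.
move=> c0 [oB sB]; split.
  move: oB; rewrite /orth all_map pairwise_map => /andP[/allP aB pB].
  apply/andP; split.
    by apply/allP => b /aB hb; rewrite /= normZ !mulf_divneq0 ?invol_neq0.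
  apply: sub_pairwise pB => b d /= /eqP bd.
  by rewrite hformZl hformZr bd mul0r mulr0.
move=> v; apply: span_sub (sB v) => b bB.
rewrite -[b in span _ b]scale1r -(mulVr (divE (c0 b))) -scalerA.
by apply: spanZ; apply: span_mem; apply: (map_f (fun b => c b *: b)).
Qed.

Lemma orth_basis_perm h (B B' : seq 'rV[E]_(hdim h)) :
  perm_eq B B' -> orth_basis h B -> orth_basis h B'.
Proof.
move=> pB [oB sB]; split; first exact: orth_perm oB.
by move=> v; apply: span_sub (sB v) => b bB; apply: span_mem; rewrite -(perm_mem pB).
Qed.

End OrthogonalBases.

(** * Generators and relations for the Witt group *)

HB.instance Definition _ (E : unitRingType) (rho : involution E) (e : bool) :=
  [isSub for @suval E rho e].

Section WittClasses.
Variables (E : unitRingType) (rho : involution E).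
Hypotheses (divE : is_division E) (two_neq0 : (2 : E) != 0).
Implicit Types (h k : herm_form rho false) (u v : E).

Lemma symunit_subproof u : rho u = u -> u != 0 ->
  (rho u == (-1) ^+ false * u) && (u \is a GRing.unit).
Proof. by move=> -> /divE ->; rewrite mul1r eqxx. Qed.

Lemma suval_sym (u : symunit rho false) : rho (suval u) = suval u.
Proof. by have /andP[/eqP-> _] := suP u; rewrite mul1r. Qed.

Lemma suval_neq0 (u : symunit rho false) : suval u != 0.
Proof.
have /andP[_] := suP u; apply: contraTneq => ->; apply/unitrP => -[x [_ /eqP]].
by rewrite mul0r eq_sym oner_eq0.
Qed.

(** Extended by 0 to elements that are not symmetric units, so that it can be
    treated as a function on E. *)
Definition unit_class u : witt rho false :=
  if (insub u : option (symunit rho false)) is Some w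
  then witt_class (diag1 w) else 0.

Lemma unit_classE (w : symunit rho false) :
  unit_class (suval w) = witt_class (diag1 w).
Proof. by rewrite /unit_class (valK w). Qed.

Lemma witt_class_isometry h k : isometry h k -> witt_class h = witt_class k.
Proof. by move=> /isom_classP hk; rewrite /witt_class hk. Qed.

Lemma witt_class_osum h k : witt_class (osum h k) = witt_class h + witt_class k.
Proof.
by rewrite /witt_class isom_class_osum; apply/esym/(etrans (witt_pairD _ _)); rewrite /= addr0.
Qed.

Lemma witt_class_hyp n : witt_class (hyp rho false n) = 0.
Proof.
apply/witt_pairP; exists n, (n + n)%N, 0.
by rewrite /= !addr0 add0r isom_class_hyp.
Qed.

Lemma diag_form_ext n (u u' : 'I_n -> symunit rho false) :
  (forall i, suval (u i) = suval (u' i)) -> isometry (diag_form u) (diag_form u').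
Proof.
move=> uu'; exists id; split=> //; first by exists id.
by move=> v w; rewrite /= /diag_val; apply: eq_bigr => i _; rewrite uu'.
Qed.

Lemma witt_class_diag n (u : 'I_n -> symunit rho false) :
  witt_class (diag_form u) = \sum_i unit_class (suval (u i)).
Proof.
elim: n u => [|n IH] u.
  rewrite big_ord0; apply: (@etrans _ _ (witt_class (fzero rho false))) => //.
  apply: witt_class_isometry; exists id; split=> //; first by exists id.
  by move=> v w; rewrite /= /diag_val big_ord0.
rewrite (witt_class_isometry (@diag_osum _ _ 1 n u)) witt_class_osum IH big_ord_recl.
congr (_ + _).
  rewrite unit_classE; apply: witt_class_isometry; apply: diag_form_ext => i.
  by rewrite (ord1 i); congr (suval (u _)); apply: val_inj.
by apply: eq_bigr => i _; congr (unit_class (suval (u _))); apply: val_inj.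
Qed.

Lemma orth_basis_diag h B : orth_basis h B ->
  exists u : 'I_(size B) -> symunit rho false,
    (forall i, suval (u i) = h B`_i B`_i) /\ isometry (diag_form u) h.
Proof.
move=> oB; have /andP[/allP hB _] := proj1 oB.
have hBi (i : 'I_(size B)) : h B`_i B`_i != 0 by apply: hB; apply: mem_nth.
exists (fun i : 'I_(size B) => SymUnit (symunit_subproof (hform_diag_sym B`_i) (hBi i))).
by split=> //; apply: orth_basis_isometry.
Qed.

Lemma witt_class_orth_basis h B : orth_basis h B ->
  witt_class h = \sum_(b <- B) unit_class (h b b).
Proof.
move=> oB; have [u [uE /witt_class_isometry<-]] := orth_basis_diag oB.
rewrite witt_class_diag (big_nth 0) big_mkord.
by apply: eq_bigr => i _; rewrite uE.
Qed.

Lemma diag1E (w : symunit rho false) (c d : E) :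
  (diag1 w) (const_mx c) (const_mx d) = c * suval w * rho d.
Proof. by rewrite /= /diag_val big_ord1 !mxE. Qed.

Lemma orth_basis_diag1 (w : symunit rho false) (c : E) : c != 0 ->
  orth_basis (diag1 w) [:: const_mx c].
Proof.
move=> c0; split.
  apply/orth_cons; split=> //.
  by rewrite diag1E !mulf_divneq0 ?suval_neq0 ?invol_neq0.
move=> v; have -> : v = (v 0 0 * c^-1) *: const_mx c + 0.
  by apply/rowP => i; rewrite !mxE (ord1 i) addr0 mulrVK ?divE.
by apply: spanZD; [rewrite inE eqxx | apply: span0].
Qed.

(** The hyperbolic plane represents every symmetric u: the vectors (1, u/2) and
    (1, -u/2) are orthogonal, of norms u and -u. *)
Lemma orth_basis_hyp1 u : u != 0 -> rho u = u ->
  exists x y : 'rV[E]_(hdim (hyp rho false 1)),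
    [/\ orth_basis (hyp rho false 1) [:: x; y], hyp rho false 1 x x = u
      & hyp rho false 1 y y = - u].
Proof.
move=> u0 uS.
have two_comm d : 2^-1 * d = d * 2^-1 by apply/esym/commrV/commr_nat.
have rho2 : rho 2^-1 = 2^-1 by rewrite involV ?divE // involD invol1.
pose a := 2^-1 * u.
have a0 : a != 0 by rewrite mulf_divneq0 ?invr_neq0_div.
have aS : rho a = a by rewrite involM uS rho2 -two_comm.
have half : 2^-1 + 2^-1 = 1 :> E.
  by rewrite -[2^-1]mul1r -mulrDl; apply: divrr; apply: divE.
have aa : a + a = u by rewrite -mulrDl half mul1r.
pose h := hyp rho false 1.
pose x (s : E) : 'rV[E]_(hdim h) := row_mx (const_mx 1) (const_mx s).
have hE s t : h (x s) (x t) = rho t + s.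
  rewrite /= /hyp_val /hpair !row_mxKl !row_mxKr !big_ord1 !mxE.
  by rewrite expr0 !mul1r invol1 mulr1.
have oB : orth_basis h [:: x a; x (- a)].
  have o : orth [:: x a; x (- a)].
    apply/orth_cons; rewrite hE aS aa; split=> //.
      by move=> c; rewrite inE => /eqP->; rewrite hE involN aS addNr.
    by apply/orth_cons; rewrite hE involN aS -opprD aa oppr_eq0; split.
  split=> // w.
  have xa : span [:: x a; x (- a)] (x a) by apply: span_mem; rewrite inE eqxx.
  have xNa : span [:: x a; x (- a)] (x (- a)) by apply: span_mem; rewrite !inE eqxx orbT.
  have e1 : span [:: x a; x (- a)] (row_mx (const_mx 1) 0).
    have -> : row_mx (const_mx 1) 0 = 2^-1 *: (x a + x (- a)).
      rewrite add_row_mx scale_row_mx; congr row_mx; apply/rowP => i; rewrite !mxE.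
        by rewrite -[1 + 1]/(2%:R) mulVr ?divE.
      by rewrite subrr mulr0.
    by apply: spanZ; apply: spanD.
  have e2 : span [:: x a; x (- a)] (row_mx 0 (const_mx 1)).
    have -> : row_mx 0 (const_mx 1) = u^-1 *: (x a - x (- a)).
      rewrite opp_row_mx add_row_mx scale_row_mx; congr row_mx; apply/rowP => i; rewrite !mxE.
        by rewrite subrr mulr0.
      by rewrite opprK aa mulVr ?divE.
    by apply: spanZ; apply: spanB.
  have -> : w = (lsubmx w 0 0) *: row_mx (const_mx 1) 0 + (rsubmx w 0 0) *: row_mx 0 (const_mx 1).
    rewrite -[w in LHS]hsubmxK !scale_row_mx add_row_mx !scaler0 addr0 add0r.
    by congr row_mx; apply/rowP => i; rewrite (ord1 i) !mxE mulr1.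
  by apply: spanD; apply: spanZ.
exists (x a), (x (- a)); split=> //; rewrite hE ?involN aS ?aa //.
by rewrite -opprD aa.
Qed.

(** Each relation compares two orthogonal bases of one form, of dimension 1 for
    the first and 2 for the second, while the third one computes the hyperbolic
    plane. *)
Lemma unit_class_invariant : diagonal_invariant rho unit_class.
Proof.
split=> [c u c0 u0 uS|u v u0 v0 uS vS uv|u u0 uS].
- pose w := SymUnit (symunit_subproof uS u0).
  rewrite -[u]/(suval w) unit_classE (witt_class_orth_basis (orth_basis_diag1 w c0)).
  by rewrite big_seq1 diag1E.
- pose wu := SymUnit (symunit_subproof uS u0).
  pose wv := SymUnit (symunit_subproof vS v0); pose h := osum (diag1 wu) (diag1 wv).
  pose x : 'rV[E]_(hdim h) := row_mx (const_mx 1) 0.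
  pose y : 'rV[E]_(hdim h) := row_mx 0 (const_mx 1).
  have hx : h x x = u.
    by rewrite /= /osum_val !row_mxKl !row_mxKr hform0l addr0 diag1E invol1 mulr1 mul1r.
  have hy : h y y = v.
    by rewrite /= /osum_val !row_mxKl !row_mxKr hform0l add0r diag1E invol1 mulr1 mul1r.
  have [oB sB] : orth_basis h [:: x; y].
    by have := orth_basis_osum (orth_basis_diag1 wu (oner_neq0 E)) (orth_basis_diag1 wv (oner_neq0 E)).
  have xy : h x y = 0 by case/orth_cons: oB => _ -> //; rewrite inE.
  (* For the zero function, chain_binary is the bare change of basis. *)
  have f0 : diagonal_invariant rho (fun _ : E => 0 : int) by split=> *; rewrite ?addr0.
  have [|oB' sB' _] := chain_binary divE f0 (h := h) (v := x) (w := y) (B := [::]) _ oB.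
    by rewrite normD // hx hy.
  have oB2 : orth_basis h [:: x + y; (h x x)^-1 *: x - (h y y)^-1 *: y].
    by split=> // z; apply/sB'.
  have := witt_class_orth_basis oB2; rewrite (witt_class_orth_basis (conj oB sB)).
  rewrite !big_cons !big_nil !addr0 hx hy (normD xy) hx hy -scaleNr => ->.
  congr (_ + unit_class _); rewrite normD; last by rewrite hformZl hformZr xy mul0r mulr0.
  rewrite !normZ hx hy involN !involV ?divE // uS vS mulNr mulrNN.
  by rewrite !mulVr ?divE // !mul1r.
- have [x [y [oB hx hy]]] := orth_basis_hyp1 u0 uS.
  have := witt_class_orth_basis oB; rewrite witt_class_hyp !big_cons big_nil addr0.
  by rewrite hx hy => <-.
Qed.

Section UniversalProperty.
Variables (G : zmodType) (f : E -> G) (finv : diagonal_invariant rho f).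

(** The basis is chosen arbitrarily; [form_valueE] shows that the value does not
    depend on it. *)
Definition form_value h := diag_sum f (projT1 (cid (orth_basis_ex divE two_neq0 h))).

Lemma form_valueE h B : orth_basis h B -> form_value h = diag_sum f B.
Proof.
rewrite /form_value; case: cid => C /= [oC sC] [oB sB].
by apply: (diag_sum_span divE two_neq0 finv) => // v; split.
Qed.

Lemma form_value_isometry h k : isometry h k -> form_value h = form_value k.
Proof.
case=> F [linF bijF hF]; have [B oB] := orth_basis_ex divE two_neq0 h.
rewrite (form_valueE oB) (form_valueE (orth_basis_transport linF bijF hF oB)).
by rewrite /diag_sum big_map; apply: eq_bigr => b _; rewrite hF.
Qed.

Lemma form_value_osum h k : form_value (osum h k) = form_value h + form_value k.
Proof.
have [B oB] := orth_basis_ex divE two_neq0 h; have [C oC] := orth_basis_ex divE two_neq0 k.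
rewrite (form_valueE oB) (form_valueE oC) (form_valueE (orth_basis_osum oB oC)).
rewrite /diag_sum big_cat !big_map; congr (_ + _); apply: eq_bigr => b _.
  by rewrite /= /osum_val !row_mxKl !row_mxKr hform0l addr0.
by rewrite /= /osum_val !row_mxKl !row_mxKr hform0l add0r.
Qed.

(** Reduces by additivity to the hyperbolic plane, which is <1> + <-1>. *)
Lemma form_value_hyp n : form_value (hyp rho false n) = 0.
Proof.
elim: n => [|n IH].
  rewrite (@form_valueE _ [::]) /diag_sum ?big_nil //.
  by split=> // v; rewrite [v]thinmx0; apply: span0.
rewrite -add1n -(form_value_isometry (osum_hyp rho false 1 n)) form_value_osum IH addr0.
have [x [y [oB hx hy]]] := orth_basis_hyp1 (oner_neq0 E) (invol1 rho).
rewrite (form_valueE oB) /diag_sum !big_cons big_nil addr0 hx hy.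
exact: (dinv_opp finv (oner_neq0 E) (invol1 rho)).
Qed.

Definition iclass_value (x : iclass rho false) := form_value (repr x).

Lemma iclass_valueE h : iclass_value (isom_class h) = form_value h.
Proof. by apply: form_value_isometry; apply/isom_classP; rewrite isom_class_repr. Qed.

Lemma iclass_valueD x y : iclass_value (x + y) = iclass_value x + iclass_value y.
Proof.
rewrite -[x]isom_class_repr -[y]isom_class_repr.
rewrite -[X in iclass_value X]isom_class_osum !iclass_valueE.
exact: form_value_osum.
Qed.

Definition witt_value (x : witt rho false) :=
  iclass_value (repr x).1 - iclass_value (repr x).2.

Lemma witt_value_pair x : witt_value (witt_pair x) = iclass_value x.1 - iclass_value x.2.
Proof.
rewrite /witt_value; have /witt_pairP[m [n [k]]] := witt_pair_repr (witt_pair x).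
move/(congr1 iclass_value); rewrite !iclass_valueD !iclass_valueE !form_value_hyp !addr0.
move=> /addIr e; apply/eqP; rewrite subr_eq addrAC eq_sym subr_eq.
by rewrite e addrC.
Qed.

Lemma witt_value_is_additive : zmod_morphism witt_value.
Proof.
move=> x y; rewrite -[x]witt_pair_repr -[y]witt_pair_repr.
move: (repr x) (repr y) => {}x {}y.
have -> : witt_pair x - witt_pair y = witt_pair (x.1 + y.2, x.2 + y.1).
  by rewrite -[LHS]/(witt_add _ (witt_opp _)) witt_pairN witt_pairD.
by rewrite !witt_value_pair /= !iclass_valueD opprD opprB addrACA.
Qed.

End UniversalProperty.

(** The existence half of the universal property: the value of a form is
    invariant under isometry, additive and zero on hyperbolic spaces, so it
    extends to formal differences. *)
Theorem witt_lift (G : zmodType) (f : E -> G) : diagonal_invariant rho f ->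
  exists Phi : {additive witt rho false -> G},
    forall u, u != 0 -> rho u = u -> Phi (unit_class u) = f u.
Proof.
move=> finv; pose Phi := HB.pack_for {additive witt rho false -> G} (witt_value f)
  (GRing.isZmodMorphism.Build _ _ _ (witt_value_is_additive finv)).
exists Phi => u u0 uS.
pose w := SymUnit (symunit_subproof uS u0).
rewrite -[u]/(suval w) unit_classE /= witt_value_pair //= iclass_valueE //.
have /eqP := iclass_valueD finv 0 0; rewrite addr0 -subr_eq subrr => /eqP <-.
rewrite subr0 (form_valueE finv (orth_basis_diag1 w (oner_neq0 E))).
by rewrite /diag_sum big_seq1 diag1E invol1 mulr1 mul1r.
Qed.

(** The uniqueness half: forms are diagonalizable, hence the classes <u>
    generate. *)
Lemma witt_additive_ext (G : zmodType) (f g : witt rho false -> G) :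
  zmod_morphism f -> zmod_morphism g ->
  (forall u, u != 0 -> rho u = u -> f (unit_class u) = g (unit_class u)) ->
  f =1 g.
Proof.
move=> fB gB ext x.
pose F := HB.pack_for {additive witt rho false -> G} f (GRing.isZmodMorphism.Build _ _ _ fB).
pose H := HB.pack_for {additive witt rho false -> G} g (GRing.isZmodMorphism.Build _ _ _ gB).
have FH h : F (witt_class h) = H (witt_class h).
  have [B oB] := orth_basis_ex divE two_neq0 h.
  rewrite (witt_class_orth_basis oB) !raddf_sum; apply: eq_big_seq => b bB.
  by case/andP: (proj1 oB) => /allP/(_ b bB) hb _; apply: ext => //; apply: hform_diag_sym.
rewrite -[x]witt_pair_repr; case: (repr x) => p q.
have -> : witt_pair (p, q) = witt_class (repr p) - witt_class (repr q).
  rewrite -[RHS]/(witt_add _ (witt_opp _)) witt_pairN witt_pairD /= addr0 add0r.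
  by rewrite !isom_class_repr.
by rewrite fB gB; congr (_ - _); apply: FH.
Qed.

End WittClasses.

Arguments unit_class {E} rho u.
Arguments unit_class_invariant {E} rho divE two_neq0.

(** * Square roots of 1-units in the valued field *)

Section ValuationTheory.
Variables (K : fieldType) (nu : cdvaluation K).
Implicit Types (x y t : K) (n : int).

Lemma vge0 n : vge nu n 0.
Proof. by rewrite /vge eqxx. Qed.

Lemma vgeE n x : x != 0 -> vge nu n x = (n <= nu x).
Proof. by rewrite /vge => /negPf->. Qed.

Lemma vge_le m n x : m <= n -> vge nu n x -> vge nu m x.
Proof. by rewrite /vge => mn /orP[->//|nx]; rewrite (le_trans mn nx) orbT. Qed.

Lemma vgeB n x y : vge nu n x -> vge nu n y -> vge nu n (x - y).
Proof. by move=> hx hy; apply: vgeD; rewrite ?vgeN. Qed.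

Lemma vge1_0 n : n <= 0 -> vge nu n 1.
Proof. by move=> n0; rewrite vgeE ?oner_neq0 // cdv1. Qed.

Lemma vgeMl n x y : vge nu 0 x -> vge nu n y -> vge nu n (x * y).
Proof. by move=> hx hy; rewrite -[n]add0r; apply: vgeM. Qed.

Lemma residueE x : x \in vring nu -> exists2 r : vinteger nu,
  val r = x & residue nu x = \pi_(residue_field nu) r.
Proof. by move=> hx; exists (insubd 0 x); rewrite ?val_insubd ?hx. Qed.

Lemma residue_val (r : vinteger nu) : residue nu (val r) = \pi_(residue_field nu) r.
Proof. by rewrite /residue valKd. Qed.

Lemma residueD x y : vge nu 0 x -> vge nu 0 y ->
  residue nu (x + y) = residue nu x + residue nu y.
Proof.
move=> /residueE[r <- ->] /residueE[s <- ->].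
by rewrite -rmorphD residue_val rmorphD.
Qed.

Lemma residueM x y : vge nu 0 x -> vge nu 0 y ->
  residue nu (x * y) = residue nu x * residue nu y.
Proof.
move=> /residueE[r <- ->] /residueE[s <- ->].
by rewrite -rmorphM residue_val rmorphM.
Qed.

Lemma residueN x : vge nu 0 x -> residue nu (- x) = - residue nu x.
Proof. by move=> /residueE[r <- ->]; rewrite -rmorphN residue_val rmorphN. Qed.

Lemma residue1 : residue nu 1 = 1.
Proof. by rewrite -(rmorph1 (val : vinteger nu -> K)) residue_val rmorph1. Qed.

Lemma residue_vge1 x : vge nu 0 x -> (residue nu x == 0) = vge nu 1 x.
Proof. by move=> /residueE[r <- ->]; rewrite residue_eq0 vmax_idealE. Qed.

Lemma repr_vge0 (c : residue_field nu) : vge nu 0 (val (repr c)).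
Proof. by have := valP (repr c). Qed.

Lemma vunit_vge x : vunit nu x -> vge nu 0 x /\ nu x = 0.
Proof.
case/andP=> /andP[]; rewrite !vringE => hx x0 hi; split=> //.
by move: hi hx; rewrite !vgeE ?invr_eq0 // cdvV //; lia.
Qed.

Lemma vunitP x : vge nu 0 x -> ~~ vge nu 1 x -> x != 0 /\ nu x = 0.
Proof.
have [->|x0] := eqVneq x 0; first by rewrite !vge0.
by rewrite !vgeE // => h0 h1; split=> //; lia.
Qed.

Section Hensel.
Hypothesis char_residue : 2%N \notin [pchar residue_field nu].

Lemma residue_two_neq0 : 2 != 0 :> residue_field nu.
Proof. by move: char_residue; rewrite inE. Qed.

Lemma two_vunit : (2 : K) != 0 /\ nu 2 = 0.
Proof.
apply: vunitP; first by apply: vgeD; apply: vge1_0.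
rewrite -residue_vge1; last by apply: vgeD; apply: vge1_0.
by rewrite residueD ?vge1_0 // residue1 residue_two_neq0.
Qed.

Lemma half_vge0 : vge nu 0 2^-1.
Proof. by have [t0 t1] := two_vunit; rewrite vgeE ?invr_eq0 // cdvV // t1. Qed.

(** The sequence y (n+1) = y n - (y n ^ 2 - t) / 2, y 0 = 1, is Newton's iteration
    with the derivative frozen at its residue 2.  If e is the correction, the new
    error is e^2 - 2 e (y n - 1), so its valuation increases by at least 1 at
    each step; the limit exists by completeness. *)
Lemma sqrt_one_unit t : vge nu 1 (t - 1) -> exists2 s, s ^+ 2 = t & vge nu 1 (s - 1).
Proof.
move=> ht; have [two0 _] := two_vunit.
pose y := fix y (n : nat) : K := if n is m.+1 then y m - (y m ^+ 2 - t) / 2 else 1.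
have yS (n : nat) : y n.+1 = y n - (y n ^+ 2 - t) / 2 by [].
have yP (n : nat) : vge nu 1 (y n - 1) /\ vge nu n.+1%:Z (y n ^+ 2 - t).
  elim: n => [|n [y1 yt]].
    by rewrite /= subrr vge0 expr1n -opprB vgeN.
  have y2 : vge nu n.+1%:Z ((y n ^+ 2 - t) / 2) by rewrite mulrC; apply: vgeMl half_vge0 _.
  rewrite yS; split.
    by rewrite addrAC; apply: vgeB => //; apply: vge_le y2.
  set e := (y n ^+ 2 - t) / 2 in y2 *.
  have eE : y n ^+ 2 - t = e * 2 by rewrite /e divfK.
  have -> : (y n - e) ^+ 2 - t = e * e - (y n - 1) * (e * 2).
    rewrite sqrrB addrAC; have -> : y n ^+ 2 = e * 2 + t by rewrite -eE subrK.
    by ring.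
  apply: vgeB.
    by apply: (@vge_le _ (n.+1%:Z + n.+1%:Z)); [lia | apply: vgeM].
  apply: (@vge_le _ (1 + n.+1%:Z)); first by lia.
  by apply: vgeM => //; rewrite -eE.
have yC (n m : nat) : (n <= m)%N -> vge nu n.+1%:Z (y m - y n).
  elim: m => [|m IH]; first by rewrite leqn0 => /eqP->; rewrite subrr vge0.
  rewrite leq_eqVlt => /orP[/eqP<-|nm]; first by rewrite subrr vge0.
  rewrite yS addrAC; apply: vgeB; first exact: IH.
  rewrite mulrC; apply: vgeMl half_vge0 _.
  by apply: vge_le (proj2 (yP m)); lia.
have [|l hl] := cdv_complete (c := nu) (u := y).
  move=> N; exists `|N|%N => m n Nm Nn; have [mn|nm] := leqP m n.
    by rewrite -opprB vgeN; apply: vge_le (yC _ _ mn); lia.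
  by apply: vge_le (yC _ _ (ltnW nm)); lia.
have l1 : vge nu 1 (l - 1).
  have [n /(_ n (leqnn n)) hn] := hl 1.
  have -> : l - 1 = (y n - 1) - (y n - l) by ring.
  by apply: vgeB => //; case: (yP n).
exists l => //; apply/eqP; rewrite -subr_eq0; apply/eqP.
have small N : vge nu N (l ^+ 2 - t).
  have [n0 hn] := hl `|N|%:Z; pose n := (n0 + `|N|)%N.
  have {}hn : vge nu `|N|%:Z (y n - l) by apply: hn; rewrite leq_addr.
  have -> : l ^+ 2 - t = (y n ^+ 2 - t) - ((y n - 1) + (l - 1) + 2) * (y n - l) by ring.
  apply: vgeB; first by apply: vge_le (proj2 (yP n)); lia.
  apply: vgeMl; last by apply: vge_le hn; lia.
  apply: vgeD; last by apply: vgeD; apply: vge1_0.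
  by apply: vgeD; [apply: vge_le (proj1 (yP n)) | apply: vge_le l1].
apply/eqP; apply: contraT => lt0; have := small (nu (l ^+ 2 - t) + 1).
by rewrite vgeE //; lia.
Qed.

(** Modulo the maximal ideal, c x^2 = - r, so - r / (c x^2) is a 1-unit, and x can
    be multiplied by its square root. *)
Lemma isotropic_lift (c x r : K) : c != 0 -> nu c = 0 -> x != 0 -> nu x = 0 ->
  vge nu 1 (c * x ^+ 2 + r) -> exists2 y, y != 0 & c * y ^+ 2 + r = 0.
Proof.
move=> c0 nc x0 nx hr; pose w := c * x ^+ 2.
have w0 : w != 0 by rewrite mulf_neq0 ?expf_neq0.
have nw : nu w = 0 by rewrite /w cdvM ?expf_neq0 // expr2 cdvM // nc nx.
have [|s s2 s1] := @sqrt_one_unit (- r / w).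
  have -> : - r / w - 1 = - (w^-1 * (w + r)) by field.
  by rewrite vgeN; apply: vgeMl hr; rewrite vgeE ?invr_eq0 // cdvV // nw.
have s0 : s != 0.
  by apply: contraTneq s1 => ->; rewrite sub0r vgeN vgeE ?oner_neq0 // cdv1.
exists (s * x); first exact: mulf_neq0.
by rewrite exprMn s2 mulrCA -/w divfK ?addNr.
Qed.

End Hensel.

(** The minimum k of the valuations of the entries, 0 having valuation +oo. *)
Lemma vge_min (s : seq K) : has (fun x => x != 0) s ->
  exists k : int, all (vge nu k) s && ~~ all (vge nu (k + 1)) s.
Proof.
elim: s => // x s IH /=; have [hs _|hs] := boolP (has (fun x => x != 0) s).
  have [k /andP[ks ks1]] := IH hs; have [kx|kx] := boolP (vge nu k x).
    by exists k; rewrite kx ks negb_and ks1 orbT.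
  have x0 : x != 0 by apply: contraNneq kx => ->; apply: vge0.
  move: kx; rewrite vgeE // => kx; exists (nu x); rewrite !vgeE // lexx negb_and.
  apply/andP; split; last by lia.
  by apply/allP => y /(allP ks); apply: vge_le; lia.
rewrite orbF => x0; exists (nu x); rewrite !vgeE // lexx negb_and /=.
apply/andP; split; last by lia.
apply/allP => y ys; have -> : y = 0; last exact: vge0.
by apply/eqP; apply: contraNT hs => y0; apply/hasP; exists y.
Qed.

End ValuationTheory.

(** * The valuation of the quaternion algebra *)

Section QuaternionValuation.
Variables (K : fieldType) (nu : cdvaluation K).
Hypothesis char_residue : 2%N \notin [pchar residue_field nu].
Variables (pi : K) (pi_neq0 : pi != 0) (nu_pi : nu pi = 1).
Variables (a b : K) (a_unit : vunit nu a) (b_unit : vunit nu b).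
Hypothesis divD : is_division (quat a b).
Local Notation D := (quat a b).
Local Notation Dbar := (quat (residue nu a) (residue nu b)).
Local Notation red := (@Defs.red K nu a b).
Implicit Types (c d : D) (k n : int).

Lemma nu_piX n : nu (pi ^ n) = n.
Proof.
have nX (m : nat) : nu (pi ^+ m) = m.
  elim: m => [|m IH]; first by rewrite expr0 cdv1.
  by rewrite exprS cdvM ?expf_neq0 // IH nu_pi; lia.
case: n => m; first exact: nX.
by rewrite -[pi ^ _]/(pi ^- m.+1) cdvV ?expf_neq0 // nX.
Qed.

Lemma piX_neq0 n : pi ^ n != 0.
Proof. by rewrite expfz_neq0. Qed.

(** The filtration of D by the minimum of the valuations of the coordinates;
    [OD_qge] and [mD_qge] identify it with the one given by nu_D. *)
Definition qge n d : bool :=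
  [&& vge nu n (quat1 d), vge nu n (quatx d), vge nu n (quaty d) & vge nu n (quatz d)].

Lemma qgeD n c d : qge n c -> qge n d -> qge n (c + d).
Proof.
by case/and4P=> ? ? ? ? /and4P[? ? ? ?]; apply/and4P; split; apply: vgeD.
Qed.

Lemma qgeN n d : qge n (- d) = qge n d.
Proof. by rewrite /qge /= !vgeN. Qed.

Lemma qge_le m n d : m <= n -> qge n d -> qge m d.
Proof. by move=> mn /and4P[? ? ? ?]; apply/and4P; split; apply: vge_le mn _. Qed.

Lemma vge_piX k n (x : K) : vge nu n (pi ^ k * x) = vge nu (n - k) x.
Proof.
have [->|x0] := eqVneq x 0; first by rewrite mulr0 !vge0.
by rewrite !vgeE ?mulf_neq0 ?piX_neq0 // cdvM ?piX_neq0 // nu_piX; lia.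
Qed.

Lemma qge_piX k n d : qge n (pi ^ k *: d) = qge (n - k) d.
Proof. by rewrite /qge /= !vge_piX. Qed.

Lemma vge_unit_sqr (c x : K) n : vge nu 0 c -> vge nu n x -> vge nu (n + n) (c * x ^+ 2).
Proof. by move=> hc hx; apply: vgeMl => //; rewrite expr2; apply: vgeM. Qed.

Lemma Nrd_vge n d : qge n d -> vge nu (n + n) (Nrd d).
Proof.
have [a0 _] := vunit_vge a_unit; have [b0 _] := vunit_vge b_unit.
case/and4P=> h1 hx hy hz; rewrite /Nrd; apply: vgeD.
  apply: vgeB; [apply: vgeB|]; rewrite ?vge_unit_sqr //.
  by rewrite -[_ ^+ 2]mul1r; apply: vge_unit_sqr; rewrite ?vge1_0.
by apply: vge_unit_sqr => //; apply: vgeMl.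
Qed.

Lemma Nrd_neq0 d : d != 0 -> Nrd d != 0.
Proof. exact: divD. Qed.

(** The reduced norm of the residue algebra is anisotropic.  Otherwise Nrd d would be
    congruent to 0 with some coordinate of d a unit; as 1, - a, - b and a b are
    units, changing that coordinate alone gives a zero of Nrd in D. *)
Lemma Nrd_primitive d : qge 0 d -> ~~ qge 1 d -> ~~ vge nu 1 (Nrd d).
Proof.
have [av na] := vunit_vge a_unit; have [bv nb] := vunit_vge b_unit.
have a0 := vunit_neq0 a_unit; have b0 := vunit_neq0 b_unit.
case/and4P=> h1 hx hy hz; rewrite !negb_and => hprim; apply/negP => hN.
have lift (c x r : K) : c != 0 -> nu c = 0 -> vge nu 0 x -> ~~ vge nu 1 x ->
    Nrd d = c * x ^+ 2 + r -> exists2 y, y != 0 & c * y ^+ 2 + r = 0.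
  move=> c0 nc xv xu dE; have [x0 nx] := vunitP xv xu.
  by apply: (isotropic_lift char_residue c0 nc x0 nx); rewrite -dE.
have contra (q : D) : q != 0 -> Nrd q = 0 -> False.
  by move=> /Nrd_neq0 q0 /eqP; rewrite (negPf q0).
have Na0 : - a != 0 by rewrite oppr_eq0.
have Nb0 : - b != 0 by rewrite oppr_eq0.
have nNa : nu (- a) = 0 by rewrite cdvN.
have nNb : nu (- b) = 0 by rewrite cdvN.
have ab0 : a * b != 0 by rewrite mulf_neq0.
have nab : nu (a * b) = 0 by rewrite cdvM // na nb.
case/or4P: hprim => hu.
- have [|y y0 yE] := lift 1 _ (- a * quatx d ^+ 2 - b * quaty d ^+ 2 + a * b * quatz d ^+ 2)
    (oner_neq0 K) (cdv1 nu) h1 hu; first by rewrite /Nrd; ring.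
  apply: (contra (Quat a b y (quatx d) (quaty d) (quatz d))).
    by apply: contra_neq y0 => -[].
  by rewrite -[RHS]yE /Nrd /=; ring.
- have [|y y0 yE] := lift (- a) _ (quat1 d ^+ 2 - b * quaty d ^+ 2 + a * b * quatz d ^+ 2)
    Na0 nNa hx hu; first by rewrite /Nrd; ring.
  apply: (contra (Quat a b (quat1 d) y (quaty d) (quatz d))).
    by apply: contra_neq y0 => -[].
  by rewrite -[RHS]yE /Nrd /=; ring.
- have [|y y0 yE] := lift (- b) _ (quat1 d ^+ 2 - a * quatx d ^+ 2 + a * b * quatz d ^+ 2)
    Nb0 nNb hy hu; first by rewrite /Nrd; ring.
  apply: (contra (Quat a b (quat1 d) (quatx d) y (quatz d))).
    by apply: contra_neq y0 => -[].
  by rewrite -[RHS]yE /Nrd /=; ring.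
- have [|y y0 yE] := lift (a * b) _ (quat1 d ^+ 2 - a * quatx d ^+ 2 - b * quaty d ^+ 2)
    ab0 nab hz hu; first by rewrite /Nrd; ring.
  apply: (contra (Quat a b (quat1 d) (quatx d) (quaty d) y)).
    by apply: contra_neq y0 => -[].
  by rewrite -[RHS]yE /Nrd /=; ring.
Qed.

(** The integer nu_D(d); the division is exact for d != 0, by [nu_Nrd]. *)
Definition valD d : int := (nu (Nrd d) %/ 2)%Z.

(** Divide d by pi^k, with k the least valuation of a coordinate: the quotient
    has a norm of valuation 0, and the norm of a scalar is its square. *)
Lemma valD_spec d : d != 0 ->
  nu (Nrd d) = valD d + valD d /\ forall n, qge n d = (n <= valD d).
Proof.
move=> d0; have [|k] := @vge_min K nu [:: quat1 d; quatx d; quaty d; quatz d].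
  by apply: contra_neqT d0; rewrite /= orbF !negb_or !negbK => /and4P[/eqP ? /eqP ? /eqP ? /eqP ?]; apply: quatP.
rewrite /= !andbT -!/(qge _ d) => /andP[hk hk1].
have NE : Nrd (pi ^ (- k) *: d) = pi ^ (- k) * pi ^ (- k) * Nrd d by rewrite /Nrd /=; ring.
have p0 : qge 0 (pi ^ (- k) *: d) by rewrite qge_piX sub0r opprK.
have p1 : ~~ qge 1 (pi ^ (- k) *: d) by rewrite qge_piX opprK addrC.
have := Nrd_vge p0; have := Nrd_primitive p0 p1.
have N0 := Nrd_neq0 d0; have q0 := piX_neq0 (- k).
rewrite NE !vgeE ?mulf_neq0 // !cdvM ?mulf_neq0 // nu_piX => h1 h2.
have nE : nu (Nrd d) = k + k by move: (nu (Nrd d)) h1 h2; clear; lia.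
have -> : valD d = k by rewrite /valD nE; clear; lia.
split=> // n; apply/idP/idP => [hn|nk]; last exact: qge_le hk.
by apply: contraNT hk1; rewrite -ltNge => kn; apply: qge_le hn; rewrite -ltzD1 ltrD2r.
Qed.

Lemma nu_Nrd d : d != 0 -> nu (Nrd d) = valD d + valD d.
Proof. by move=> /valD_spec[]. Qed.

Lemma qgeE n d : d != 0 -> qge n d = (n <= valD d).
Proof. by move=> /valD_spec[]. Qed.

Lemma nuDE d : d != 0 -> nuD nu d = (valD d)%:~R.
Proof.
move=> d0; rewrite /nuD nu_Nrd // intrD -mulr2n -(mulr_natr (valD d)%:~R 2).
by rewrite mulfK.
Qed.

Lemma qge0 n : qge n 0.
Proof. by rewrite /qge /= !vge0. Qed.

Lemma OD_qge d : (d \in @OD K nu a b) = qge 0 d.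
Proof.
rewrite -topredE /= /OD; have [->|d0] := eqVneq d 0; first by rewrite qge0.
by rewrite nuDE // qgeE // ler0z.
Qed.

Lemma mD_qge d : (d \in @mD K nu a b) = qge 1 d.
Proof.
rewrite -topredE /= /mD; have [->|d0] := eqVneq d 0; first by rewrite qge0.
by rewrite nuDE // qgeE // ltr0z.
Qed.

Lemma mulD_neq0 c d : c != 0 -> d != 0 -> c * d != 0.
Proof. exact: (mulf_divneq0 divD). Qed.

Lemma invD_neq0 d : d != 0 -> d^-1 != 0.
Proof. exact: (invr_neq0_div). Qed.

Lemma valDM c d : c != 0 -> d != 0 -> valD (c * d) = valD c + valD d.
Proof.
move=> c0 d0; have := nu_Nrd (mulD_neq0 c0 d0).
rewrite NrdM cdvM ?Nrd_neq0 // !nu_Nrd //. lia.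
Qed.

Lemma valD1 : valD 1 = 0.
Proof. by have := valDM (oner_neq0 D) (oner_neq0 D); rewrite mulr1; move: (valD 1) => v; lia. Qed.

Lemma valDV d : d != 0 -> valD d^-1 = - valD d.
Proof.
move=> d0; have := valDM d0 (invD_neq0 d0).
by rewrite divrr ?divD // valD1; lia.
Qed.

Lemma valDN d : valD (- d) = valD d.
Proof. by rewrite /valD /Nrd /= !sqrrN. Qed.

Lemma qgeM m n c d : qge m c -> qge n d -> qge (m + n) (c * d).
Proof.
have [->|c0] := eqVneq c 0; first by rewrite mul0r !qge0.
have [->|d0] := eqVneq d 0; first by rewrite mulr0 !qge0.
by rewrite !qgeE ?mulD_neq0 // valDM //; lia.
Qed.

(** * Reduction modulo the maximal ideal *)

Lemma redD c d : qge 0 c -> qge 0 d -> red (c + d) = red c + red d.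
Proof. by case/and4P=> ? ? ? ? /and4P[? ? ? ?]; apply: quatP; apply: residueD. Qed.

Lemma redN d : qge 0 d -> red (- d) = - red d.
Proof. by case/and4P=> ? ? ? ?; apply: quatP; apply: residueN. Qed.

Lemma redM c d : qge 0 c -> qge 0 d -> red (c * d) = red c * red d.
Proof.
have [av _] := vunit_vge a_unit; have [bv _] := vunit_vge b_unit.
case: c d => [c1 cx cy cz] [d1 dx dy dz] /and4P[/= ? ? ? ?] /and4P[/= ? ? ? ?].
by apply: quatP => /=; rewrite !(residueD, residueM, residueN);
  repeat first [done | rewrite vgeN | apply: vgeD | apply: vgeMl].
Qed.

Lemma red1 : red 1 = 1.
Proof. by apply: quatP; rewrite /= ?residue1 ?residue0. Qed.

Lemma red_eq0 d : qge 0 d -> (red d == 0) = qge 1 d.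
Proof.
case/and4P=> h1 hx hy hz; rewrite /qge -!residue_vge1 //.
apply/eqP/and4P => [[-> -> -> ->]|[/eqP ? /eqP ? /eqP ? /eqP ?]]; first by rewrite eqxx.
exact: quatP.
Qed.

Definition qrepr (c : Dbar) : D :=
  Quat a b (val (repr (quat1 c))) (val (repr (quatx c)))
           (val (repr (quaty c))) (val (repr (quatz c))).

Lemma qge_qrepr (e : Dbar) : qge 0 (qrepr e).
Proof. by apply/and4P; split; apply: repr_vge0. Qed.

Lemma red_qrepr (e : Dbar) : red (qrepr e) = e.
Proof. by apply: quatP; apply: residue_repr. Qed.

Lemma Nrd_red d : qge 0 d -> Nrd (red d) = residue nu (Nrd d).
Proof.
have [av _] := vunit_vge a_unit; have [bv _] := vunit_vge b_unit.
case/and4P=> ? ? ? ?; rewrite /Nrd /= !expr2.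
by rewrite !(residueD, residueM, residueN);
  repeat first [done | rewrite vgeN | apply: vgeD | apply: vgeMl].
Qed.

(** Lift an element of the residue algebra and apply [Nrd_primitive]. *)
Lemma residue_division : is_division Dbar.
Proof.
move=> c c0; rewrite -[c]red_qrepr.
have h0 := qge_qrepr c.
have h1 : ~~ qge 1 (qrepr c) by have := red_eq0 h0; rewrite red_qrepr (negPf c0) => <-.
suff : Nrd (red (qrepr c)) != 0 by [].
rewrite Nrd_red // residue_vge1; first exact: Nrd_primitive.
exact: (Nrd_vge h0).
Qed.

Lemma red_reduction : red_is_reduction nu a b.
Proof.
split.
- split=> [|c d|c d]; rewrite !OD_qge.
  + by rewrite qgeE ?oner_neq0 // valD1.
  + by move=> hc hd; apply: qgeD; rewrite ?qgeN.
  + by move=> hc hd; rewrite -[0]addr0; apply: qgeM.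
- split; first exact: red1.
    by move=> c d; rewrite !OD_qge; apply: redD.
  by move=> c d; rewrite !OD_qge; apply: redM.
- by move=> d; rewrite OD_qge mD_qge; apply: red_eq0.
- by move=> c; exists (qrepr c); rewrite ?OD_qge ?qge_qrepr ?red_qrepr.
Qed.

(** * Leading coefficients *)

(** The class of d in the associated graded ring of D, where pi is identified
    with 1. *)
Definition lcoef d : Dbar := red (pi ^ (- valD d) *: d).

Lemma valD_lcoefP k d : qge k d -> red (pi ^ (- k) *: d) != 0 ->
  [/\ d != 0, valD d = k & lcoef d = red (pi ^ (- k) *: d)].
Proof.
move=> hk; rewrite red_eq0 qge_piX ?opprK ?add0r // => hk1.
have d0 : d != 0 by apply: contraNneq hk1 => ->; apply: qge0.
suff e : valD d = k by rewrite /lcoef e.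
by move: hk hk1; rewrite !qgeE //; lia.
Qed.

Lemma qge_norm d : qge 0 (pi ^ (- valD d) *: d).
Proof.
have [->|d0] := eqVneq d 0; first by rewrite scaler0 qge0.
by rewrite qge_piX qgeE // sub0r opprK.
Qed.

Lemma lcoef_neq0 d : d != 0 -> lcoef d != 0.
Proof. by move=> d0; rewrite red_eq0 ?qge_norm // qge_piX qgeE //; lia. Qed.

Lemma lcoefM c d : c != 0 -> d != 0 -> lcoef (c * d) = lcoef c * lcoef d.
Proof.
move=> c0 d0; rewrite /lcoef valDM // -redM ?qge_norm //; congr red.
by rewrite -scalerAl -scalerAr scalerA -expfzDr // opprD.
Qed.

Lemma lcoef1 : lcoef 1 = 1.
Proof. by rewrite /lcoef valD1 oppr0 expr0z scale1r red1. Qed.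

Lemma lcoefV d : d != 0 -> lcoef d^-1 = (lcoef d)^-1.
Proof.
move=> d0; have lU := residue_division (lcoef_neq0 d0).
apply: (mulrI lU); rewrite divrr // -lcoefM ?invD_neq0 //.
by rewrite divrr ?divD // lcoef1.
Qed.

Lemma lcoefN d : lcoef (- d) = - lcoef d.
Proof. by rewrite /lcoef valDN scalerN redN ?qge_norm. Qed.

Lemma lcoef_addl c d : c != 0 -> d != 0 -> valD c < valD d ->
  [/\ c + d != 0, valD (c + d) = valD c & lcoef (c + d) = lcoef c].
Proof.
move=> c0 d0 cd.
have hd : qge 1 (pi ^ (- valD c) *: d) by rewrite qge_piX qgeE //; lia.
have hd0 := qge_le ler01 hd.
have e : red (pi ^ (- valD c) *: (c + d)) = lcoef c.
  rewrite scalerDr redD ?qge_norm // -[RHS]addr0; congr (_ + _).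
  by apply/eqP; rewrite red_eq0.
rewrite -e; apply: valD_lcoefP; last by rewrite e lcoef_neq0.
by apply: qgeD; rewrite qgeE // ltW.
Qed.

Lemma lcoef_add c d : c != 0 -> d != 0 -> valD c = valD d -> lcoef c + lcoef d != 0 ->
  [/\ c + d != 0, valD (c + d) = valD c & lcoef (c + d) = lcoef c + lcoef d].
Proof.
move=> c0 d0 cd hcd.
have e : red (pi ^ (- valD c) *: (c + d)) = lcoef c + lcoef d.
  have hd : qge 0 (pi ^ (- valD c) *: d) by rewrite cd qge_norm.
  by rewrite scalerDr redD ?qge_norm // /lcoef cd.
rewrite -e; apply: valD_lcoefP; last by rewrite e.
by apply: qgeD; rewrite qgeE // cd.
Qed.

Lemma piX_scale k d : d != 0 ->
  [/\ pi ^ k *: d != 0, valD (pi ^ k *: d) = k + valD d & lcoef (pi ^ k *: d) = lcoef d].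
Proof.
move=> d0.
have e : pi ^ (- (k + valD d)) *: (pi ^ k *: d) = pi ^ (- valD d) *: d.
  by rewrite scalerA -expfzDr //; congr (pi ^ _ *: d); lia.
rewrite {2}/lcoef -e; apply: valD_lcoefP; last by rewrite e lcoef_neq0.
by rewrite qge_piX qgeE //; lia.
Qed.

Lemma valD_lcoef_unit d : qge 0 d -> red d != 0 ->
  [/\ d != 0, valD d = 0 & lcoef d = red d].
Proof.
by move=> hd rd; have := @valD_lcoefP 0 d hd; rewrite oppr0 expr0z scale1r => /(_ rd).
Qed.

(** * The involutions and hermitian lifting *)

Local Notation tx := (tau_x b (vunit_neq0 a_unit)).
Local Notation txbar := (tau_x (residue nu b) (residue_neq0 a_unit)).

Lemma tau_xE (F : fieldType) (a' b' : F) (a0 : a' != 0) (d : quat a' b') :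
  tau_x b' a0 d = Quat a' b' (quat1 d) (- quatx d) (quaty d) (quatz d).
Proof.
set t := RHS; have e : qx a' b' * quat_conj d = t * qx a' b'.
  by case: d @t => d1 dx dy dz; apply: quatP => /=; ring.
change (qx a' b' * quat_conj d * (qx a' b')^-1 = t).
by rewrite e mulrK // qx_unit.
Qed.

Lemma quat_two_neq0 (F : fieldType) (a' b' : F) : (2 : F) != 0 -> (2 : quat a' b') != 0.
Proof. by apply: contra_neq => /(congr1 (@quat1 _ _ _)). Qed.

Lemma tau_x_sym (F : fieldType) (a' b' : F) (a0 : a' != 0) (d : quat a' b') :
  (2 : F) != 0 -> tau_x b' a0 d = d <-> quatx d = 0.
Proof.
move=> two0; rewrite tau_xE; split=> [/(congr1 (@quatx _ _ _)) /= /eqP|d0]; last first.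
  by apply: quatP; rewrite //= d0 oppr0.
rewrite -subr_eq0 -opprD oppr_eq0 -mulr2n -(mulr_natl (quatx d) 2) mulf_eq0.
by rewrite (negPf two0) => /eqP.
Qed.

Let two_neq0 : (2 : K) != 0. Proof. by case: (two_vunit char_residue). Qed.
Let twoD : (2 : D) != 0. Proof. exact: quat_two_neq0. Qed.
Let twoDbar : (2 : Dbar) != 0.
Proof. by apply: quat_two_neq0; apply: residue_two_neq0. Qed.

Lemma txZ (x : K) d : tx (x *: d) = x *: tx d.
Proof. by rewrite !tau_xE; apply: quatP => //=; rewrite mulrN. Qed.

Lemma qge_tx n d : qge n (tx d) = qge n d.
Proof. by rewrite tau_xE /qge /= vgeN. Qed.

Lemma red_tx d : qge 0 d -> red (tx d) = txbar (red d).
Proof.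
by case/and4P=> ? ? ? ?; rewrite !tau_xE; apply: quatP => //=; rewrite residueN.
Qed.

Lemma valD_tx d : valD (tx d) = valD d.
Proof. by rewrite /valD tau_xE /Nrd /= sqrrN. Qed.

Lemma lcoef_tx d : lcoef (tx d) = txbar (lcoef d).
Proof. by rewrite /lcoef valD_tx -red_tx ?qge_norm // txZ. Qed.

Lemma tx_induces : induces tx txbar.
Proof.
split=> d; first by rewrite !OD_qge qge_tx.
  by rewrite !mD_qge qge_tx.
by rewrite OD_qge; apply: red_tx.
Qed.

Lemma twist_central (x : K) : x != 0 -> twist tx x%:A =1 tx.
Proof.
move=> x0 d; have xU : x%:A \is a @GRing.unit D.
  by apply: divD; apply: contra_neq x0 => /(congr1 (@quat1 _ _ _)) /=; rewrite mulr1.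
by rewrite /twist mulr_algl -mulr_algr mulrK.
Qed.

Lemma quat_char_poly c : c * c = (2 * quat1 c) *: c - (Nrd c)%:A.
Proof. by case: c => *; rewrite /Nrd; apply: quatP => /=; ring. Qed.

(** With n^2 = Nrd c, the identity c^2 = (2 c1) c - Nrd c gives
    (c + n)^2 = 2 (c1 + n) c, where c1 is the first coordinate of c.  Now
    2 (c1 + n) = 4 s^2, since (c1 + n) / 2 is a 1-unit.  That the root is a
    polynomial in c is what [hermitian_lift] uses. *)
Lemma sqrt_one_unitD c : qge 1 (c - 1) ->
  exists s t : K, (s *: (c + t%:A)) * (s *: (c + t%:A)) = c.
Proof.
move=> hc; have c1 : vge nu 1 (quat1 c - 1) by case/and4P: hc.
have NE : Nrd c - 1 = 2 * (quat1 c - 1) + Nrd (c - 1).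
  by case: c {hc c1} => *; rewrite /Nrd /=; ring.
have [|n n2 n1] := sqrt_one_unit char_residue (t := Nrd c).
  rewrite NE; apply: vgeD; last by apply: vge_le (Nrd_vge hc).
  by apply: vgeMl => //; apply: vgeD; apply: vge1_0.
have [|s s2 s1] := sqrt_one_unit char_residue (t := 2^-1 * (quat1 c + n)).
  have -> : 2^-1 * (quat1 c + n) - 1 = 2^-1 * ((quat1 c - 1) + (n - 1)) by field.
  by apply: vgeMl; [apply: half_vge0 | apply: vgeD].
have s0 : s != 0.
  by apply: contraTneq s1 => ->; rewrite sub0r vgeN vgeE ?oner_neq0 // cdv1.
exists (2 * s)^-1, n; rewrite -scalerAl -scalerAr scalerA.
have -> : (c + n%:A) * (c + n%:A) = (2 * (quat1 c + n)) *: c.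
  rewrite mulrDl !mulrDr quat_char_poly -n2 !mulr_algr mulr_algl scalerA -expr2.
  rewrite [_ *: c + _%:A]addrC addrACA subrK scalerDl; congr (_ + _).
  by rewrite -scalerDl (mulr_natl n 2).
rewrite scalerA -[RHS]scale1r; congr (_ *: _).
have -> : 2 * (quat1 c + n) = 4 * s ^+ 2 by rewrite s2; field.
by field; rewrite s0.
Qed.

(** Put c = u^-1 v, of reduction 1, and let m be its square root.  As u and v are
    symmetric, u c = c* u; m is a polynomial in c, so also m* u = u m, and
    m* u m = u m^2 = u c = v. *)
Lemma hermitian_lift u v : u != 0 -> v != 0 -> tx u = u -> tx v = v ->
  valD u = valD v -> lcoef u = lcoef v ->
  exists2 l, l != 0 & v = l * u * tx l.
Proof.
move=> u0 v0 uS vS uv luv; have uU := divD u0.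
have [|s [t e]] := @sqrt_one_unitD (u^-1 * v).
  have uv0 : u^-1 * v != 0 by rewrite mulD_neq0 ?invD_neq0.
  have val0 : valD (u^-1 * v) = 0 by rewrite valDM ?invD_neq0 // valDV // uv addNr.
  have l1 : red (u^-1 * v) = 1.
    have := lcoefM (invD_neq0 u0) v0; rewrite {1}/lcoef val0 oppr0 expr0z scale1r => ->.
    by rewrite (lcoefV u0) luv (mulVr (residue_division (lcoef_neq0 v0))).
  have h0 : qge 0 (u^-1 * v) by rewrite qgeE // val0.
  have h1 : qge 0 (1 : D) by rewrite qgeE ?oner_neq0 // valD1.
  by rewrite -red_eq0 ?qgeD ?qgeN // redD ?qgeN // redN // l1 red1 subrr.
set m := s *: _ in e; exists (tx m).
  have : m * m != 0 by rewrite e mulD_neq0 ?invD_neq0.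
  apply: contra_neq => m0.
  by rewrite -[m](involK tx) m0 invol0 mul0r.
rewrite involK.
have -> : tx m * u = u * m.
  rewrite /m txZ involD involM vS involV // uS -scalerAl -scalerAr; congr (_ *: _).
  rewrite mulrDl mulrDr mulrVK // mulrA divrr // mul1r; congr (_ + _).
  by rewrite txZ invol1 mulr_algl mulr_algr.
by rewrite -mulrA e mulrA divrr // mul1r.
Qed.

(** Valuations of the same parity are made equal by multiplying u by pi^m on both
    sides, which changes u within its congruence class. *)
Lemma unit_class_congr u v : u != 0 -> v != 0 -> tx u = u -> tx v = v ->
  odd `|valD u|%N = odd `|valD v|%N -> lcoef u = lcoef v ->
  unit_class tx u = unit_class tx v.
Proof.
move=> u0 v0 uS vS uv luv.
have [m mE] : exists m : int, valD v = valD u + (m + m).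
  by exists ((valD v - valD u) %/ 2)%Z; move: (valD u) (valD v) uv; clear; lia.
pose p : D := (pi ^ m)%:A.
have pE w : p * w * tx p = pi ^ (m + m) *: w.
  by rewrite /p txZ invol1 mulr_algl mulr_algr scalerA expfzDr.
have p0 : p != 0.
  by apply: contra_neq (piX_neq0 m) => /(congr1 (@quat1 _ _ _)) /=; rewrite mulr1.
have fD := unit_class_invariant tx divD twoD.
have [q0 qv ql] := piX_scale (m + m) u0.
have qS : tx (pi ^ (m + m) *: u) = pi ^ (m + m) *: u by rewrite txZ uS.
rewrite -(dinv_congr fD p0 u0 uS) pE.
have [||l l0 ->] := hermitian_lift q0 v0 qS vS; first by rewrite qv mE addrC.
  by rewrite ql.
by rewrite (dinv_congr fD l0 q0 qS).
Qed.

(** * The residue map on one-dimensional forms *)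

Local Notation Wbar := (witt txbar false).

Let fD := unit_class_invariant tx divD twoD.
Let fDbar := unit_class_invariant txbar residue_division twoDbar.

(** Even valuations go to the unramified component, odd ones to the ramified
    component. *)
Definition parity_inj n (w : Wbar) : (Wbar * Wbar)%type :=
  if odd `|n|%N then (0, w) else (w, 0).

Lemma parity_injD n w w' : parity_inj n w + parity_inj n w' = parity_inj n (w + w').
Proof. by rewrite /parity_inj; case: odd; congr (_, _); rewrite addr0. Qed.

Lemma parity_inj0 n : parity_inj n 0 = 0.
Proof. by rewrite /parity_inj; case: odd. Qed.

Lemma parity_inj_eq m n w : odd `|m|%N = odd `|n|%N -> parity_inj m w = parity_inj n w.
Proof. by rewrite /parity_inj => ->. Qed.

(** Larmour's map on <d>. *)
Definition residue_class d := parity_inj (valD d) (unit_class txbar (lcoef d)).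

Lemma lcoef_sym d : tx d = d -> txbar (lcoef d) = lcoef d.
Proof. by move=> dS; rewrite -lcoef_tx dS. Qed.

Lemma tx_neq0 d : d != 0 -> tx d != 0.
Proof. exact: invol_neq0. Qed.

Lemma valD_congr c u : c != 0 -> u != 0 -> valD (c * u * tx c) = valD u + (valD c + valD c).
Proof.
move=> c0 u0; have cu0 := mulD_neq0 c0 u0.
by rewrite (valDM cu0 (tx_neq0 c0)) (valDM c0 u0) valD_tx addrAC addrC.
Qed.

Lemma lcoef_congr c u : c != 0 -> u != 0 ->
  lcoef (c * u * tx c) = lcoef c * lcoef u * txbar (lcoef c).
Proof.
move=> c0 u0; have cu0 := mulD_neq0 c0 u0.
by rewrite (lcoefM cu0 (tx_neq0 c0)) (lcoefM c0 u0) lcoef_tx.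
Qed.

Lemma residue_class_congr c u : c != 0 -> u != 0 -> tx u = u ->
  residue_class (c * u * tx c) = residue_class u.
Proof.
move=> c0 u0 uS; rewrite /residue_class (valD_congr c0 u0) (lcoef_congr c0 u0).
rewrite (dinv_congr fDbar (lcoef_neq0 c0) (lcoef_neq0 u0) (lcoef_sym uS)).
by apply: parity_inj_eq; move: (valD u) (valD c); clear; lia.
Qed.

Lemma tx_inv u : u != 0 -> tx u = u -> tx u^-1 = u^-1.
Proof. by move=> u0 uS; rewrite (involV _ (divD u0)) uS. Qed.

(** u^-1 = u^-1 u (u^-1)*. *)
Lemma residue_classV u : u != 0 -> tx u = u -> residue_class u^-1 = residue_class u.
Proof.
move=> u0 uS; rewrite -(residue_class_congr (invD_neq0 u0) u0 uS).
by rewrite (tx_inv u0 uS) (mulVr (divD u0)) mul1r.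
Qed.

Lemma residue_classN u : u != 0 -> tx u = u -> residue_class u + residue_class (- u) = 0.
Proof.
move=> u0 uS; rewrite /residue_class valDN lcoefN parity_injD.
by rewrite (dinv_opp fDbar (lcoef_neq0 u0) (lcoef_sym uS)) parity_inj0.
Qed.

(** When nu_D(u) < nu_D(v), the leading term of u + v is that of u, and the leading
    term of u^-1 + v^-1 is that of v^-1. *)
Lemma residue_class_dominated u v : u != 0 -> v != 0 -> tx u = u -> tx v = v ->
  valD u < valD v ->
  residue_class u + residue_class v = residue_class (u + v) + residue_class (u^-1 + v^-1).
Proof.
move=> u0 v0 uS vS uv; have [_ e1 e2] := lcoef_addl u0 v0 uv.
have vu : valD v^-1 < valD u^-1 by rewrite (valDV u0) (valDV v0) ltrN2.
have [_ e3 e4] := lcoef_addl (invD_neq0 v0) (invD_neq0 u0) vu.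
have -> : residue_class (u + v) = residue_class u by rewrite /residue_class e1 e2.
rewrite [u^-1 + _]addrC.
have -> : residue_class (v^-1 + u^-1) = residue_class v^-1 by rewrite /residue_class e3 e4.
by rewrite (residue_classV v0 vS).
Qed.

(** The binary relation for equal valuations: if the leading coefficients do not
    cancel, it is the binary relation in the residue algebra.  If they do, both
    sides vanish: u^-1 + v^-1 = u^-1 (u + v) v^-1 has the leading coefficient
    - l^-1 w l^-1, where l and w are those of u and of u + v. *)
Lemma residue_class_invariant : diagonal_invariant tx residue_class.
Proof.
split; [exact: residue_class_congr | | exact: residue_classN].
move=> u v u0 v0 uS vS uv0.
have [uv|vu|uv] := ltgtP (valD u) (valD v); first exact: residue_class_dominated.
  apply: etrans (addrC _ _) (etrans (residue_class_dominated v0 u0 vS uS vu) _).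
  exact: (congr2 (fun x y => residue_class x + residue_class y) (addrC _ _) (addrC _ _)).
have lu0 := lcoef_neq0 u0; have lv0 := lcoef_neq0 v0.
have luS := lcoef_sym uS; have lvS := lcoef_sym vS.
have ui0 := invD_neq0 u0; have vi0 := invD_neq0 v0.
have [luv|luv] := eqVneq (lcoef u + lcoef v) 0; last first.
  have [_ e1 e2] := lcoef_add u0 v0 uv luv.
  have uvi : valD u^-1 = valD v^-1 by rewrite (valDV u0) (valDV v0) uv.
  have luvi : lcoef u^-1 + lcoef v^-1 != 0.
    by rewrite (lcoefV u0) (lcoefV v0) (invr_add_neq0 residue_division lu0 lv0 luv).
  have [_ e3 e4] := lcoef_add ui0 vi0 uvi luvi.
  have -> : residue_class (u^-1 + v^-1) =
      parity_inj (valD u) (unit_class txbar ((lcoef u)^-1 + (lcoef v)^-1)).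
    rewrite /residue_class e3 e4 (lcoefV u0) (lcoefV v0) (valDV u0).
    by apply: parity_inj_eq; rewrite abszN.
  rewrite /residue_class e1 e2 -uv.
  apply: etrans (parity_injD _ _ _) (etrans _ (esym (parity_injD _ _ _))).
  exact: congr1 (dinv_binary fDbar lu0 lv0 luS lvS luv).
have lvE : lcoef v = - lcoef u by apply/eqP; rewrite -addr_eq0 addrC luv.
have lhs0 : residue_class u + residue_class v = 0.
  rewrite /residue_class -uv lvE; apply: etrans (parity_injD _ _ _) _.
  by rewrite (dinv_opp fDbar lu0 luS) parity_inj0.
apply: (etrans lhs0).
have wS : tx (u + v) = u + v by rewrite involD uS vS.
have li0 := invr_neq0_div lu0.
have liS : txbar (lcoef u)^-1 = (lcoef u)^-1.
  by rewrite (involV _ (residue_division lu0)) luS.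
have uvi0 := mulD_neq0 ui0 uv0.
rewrite (invr_add divD u0 v0) [residue_class (_ * _)]/residue_class.
rewrite (valDM uvi0 vi0) (valDM ui0 uv0) (lcoefM uvi0 vi0) (lcoefM ui0 uv0).
rewrite (lcoefV u0) (lcoefV v0) lvE invrN mulrN -mulNr -mulrN.
have lw0 := lcoef_neq0 uv0; have lwS := lcoef_sym wS.
rewrite -{2}liS (dinv_congr fDbar li0 _ _); last first.
- by rewrite involN lwS.
- by rewrite oppr_eq0.
have -> : parity_inj (valD u^-1 + valD (u + v) + valD v^-1) =1 parity_inj (valD (u + v)).
  move=> w; apply: parity_inj_eq; rewrite (valDV u0) (valDV v0) -uv.
  by move: (valD u) (valD (u + v)); clear; lia.
rewrite /residue_class; apply/esym/(etrans (parity_injD _ _ _)).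
by rewrite (dinv_opp fDbar lw0 lwS) parity_inj0.
Qed.

(** * Lifting one-dimensional forms *)

(** A lift with zero x-coordinate, since these are the symmetric elements. *)
Definition sym_repr (e : Dbar) : D :=
  Quat a b (quat1 (qrepr e)) 0 (quaty (qrepr e)) (quatz (qrepr e)).

Lemma sym_reprP (e : Dbar) : e != 0 -> txbar e = e ->
  [/\ sym_repr e != 0, tx (sym_repr e) = sym_repr e, valD (sym_repr e) = 0
    & lcoef (sym_repr e) = e].
Proof.
move=> e0 eS; have ex := proj1 (tau_x_sym _ _ (residue_two_neq0 char_residue)) eS.
have hq : qge 0 (sym_repr e).
  by apply/and4P; split; rewrite ?vge0 //; apply: repr_vge0.
have rE : red (sym_repr e) = e.
  by apply: quatP; rewrite /= ?residue0 ?ex //; apply: residue_repr.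
have [s0 s1 s2] := valD_lcoef_unit hq (etrans (congr1 (fun x => x != 0) rE) e0).
by split=> //; [apply/tau_x_sym | rewrite s2].
Qed.

Definition lift_class k (e : Dbar) : witt tx false := unit_class tx (pi ^ k *: sym_repr e).

Lemma scaled_sym_reprP k (e : Dbar) : e != 0 -> txbar e = e ->
  let u := pi ^ k *: sym_repr e in
  [/\ u != 0, tx u = u, valD u = k & lcoef u = e].
Proof.
move=> e0 eS u; have [s0 s1 s2 s3] := sym_reprP e0 eS.
have [u0 u1 u2] := piX_scale k s0.
by split=> //; rewrite /u ?txZ ?s1 // ?u1 ?u2 ?s2 ?addr0 ?s3.
Qed.

(** Independence of the lift: any symmetric u with leading coefficient e and with
    valuation of the parity of k can be used. *)
Lemma lift_classE k u : u != 0 -> tx u = u -> odd `|valD u|%N = odd `|k|%N ->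
  lift_class k (lcoef u) = unit_class tx u.
Proof.
move=> u0 uS uk; have [s0 s1 s2 s3] := scaled_sym_reprP k (lcoef_neq0 u0) (lcoef_sym uS).
by apply: unit_class_congr; rewrite ?s2.
Qed.

(** Both sides of each relation are computed with convenient lifts, namely those
    obtained from lifts of the entries by the operations of D. *)
Lemma lift_class_invariant k : diagonal_invariant txbar (lift_class k).
Proof.
split=> [c u c0 u0 uS|u v u0 v0 uS vS uv0|u u0 uS].
- have [U0 US Uv Ul] := scaled_sym_reprP k u0 uS; set U := pi ^ k *: _ in U0 US Uv Ul.
  have rc : red (qrepr c) != 0.
    rewrite red_qrepr.
    exact c0.
  have [C0 Cv Cl] := valD_lcoef_unit (qge_qrepr c) rc; rewrite red_qrepr in Cl.
  rewrite -Cl -{1}Ul -(lcoef_congr C0 U0) [in RHS]/lift_class -/U.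
  rewrite lift_classE ?(dinv_congr fD C0 U0 US) //.
  + by rewrite (mulD_neq0 (mulD_neq0 C0 U0) (tx_neq0 C0)).
  + by rewrite (involM tx (_ * U)) (involK tx) (involM tx _ U) US mulrA.
  + by rewrite (valD_congr C0 U0) Cv Uv !addr0.
- have [U0 US Uv Ul] := scaled_sym_reprP k u0 uS; set U := pi ^ k *: _ in U0 US Uv Ul.
  have [V0 VS Vv Vl] := scaled_sym_reprP k v0 vS; set V := pi ^ k *: _ in V0 VS Vv Vl.
  have [|UV0 UVv UVl] := lcoef_add U0 V0 (etrans Uv (esym Vv)); first by rewrite Ul Vl.
  have [||W0 Wv Wl] := lcoef_add (invD_neq0 U0) (invD_neq0 V0).
  + by rewrite (valDV U0) (valDV V0) Uv Vv.
  + by rewrite (lcoefV U0) (lcoefV V0) Ul Vl (invr_add_neq0 residue_division u0 v0 uv0).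
  have -> : lift_class k (u + v) = unit_class tx (U + V).
    by rewrite -Ul -Vl -UVl; apply: lift_classE; rewrite ?involD ?US ?VS // UVv Uv.
  have -> : lift_class k (u^-1 + v^-1) = unit_class tx (U^-1 + V^-1).
    rewrite -[in LHS]Ul -[in LHS]Vl -(lcoefV U0) -(lcoefV V0) -Wl.
    apply: lift_classE => //; first by rewrite involD (tx_inv U0 US) (tx_inv V0 VS).
    by rewrite Wv (valDV U0) Uv abszN.
  exact: (dinv_binary fD U0 V0 US VS UV0).
- have [U0 US Uv Ul] := scaled_sym_reprP k u0 uS; set U := pi ^ k *: _ in U0 US Uv Ul.
  have -> : lift_class k (- u) = unit_class tx (- U).
    rewrite -[in LHS]Ul -lcoefN; apply: lift_classE; rewrite ?oppr_eq0 ?involN ?US //.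
    by rewrite valDN Uv.
  exact: (dinv_opp fD U0 US).
Qed.

Lemma residue_class_lift k (e : Dbar) : e != 0 -> txbar e = e ->
  residue_class (pi ^ k *: sym_repr e) = parity_inj k (unit_class txbar e).
Proof.
by move=> e0 eS; have [_ _ s2 s3] := scaled_sym_reprP k e0 eS; rewrite /residue_class s2 s3.
Qed.

(** * Larmour decompositions *)

Local Notation pi' := (pi%:A : D).

Lemma pi'_inv d : d / pi' = pi^-1 *: d.
Proof.
have pU : pi' \is a @GRing.unit D.
  by apply: divD; apply: contra_neq pi_neq0 => /(congr1 (@quat1 _ _ _)) /=; rewrite mulr1.
apply: (mulIr pU); rewrite mulrVK // mulr_algr scalerA.
by rewrite (mulfV pi_neq0) scale1r.
Qed.

Lemma nuD_pi' : nuD nu pi' = 1.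
Proof.
have [p0 pv _] := piX_scale 1 (oner_neq0 D).
by move: p0 pv; rewrite expr1z valD1 addr0 => p0 pv; rewrite nuDE // pv.
Qed.

(** Multiply the vectors of an orthogonal basis by powers of pi; this shifts the
    valuations of their norms by even integers, so they become 0 or 1. *)
Lemma larmour_decomposition_ex (h : herm_form tx false) :
  exists q (u : 'I_q -> symunit tx false) r (v : 'I_r -> symunit tx false),
    larmour_decomposition nu pi' h u v.
Proof.
have [B oB] := orth_basis_ex divD twoD h.
pose k x := (- (valD (h x x) %/ 2)%Z)%R; pose c x : D := (pi ^ k x)%:A.
have c0 x : c x != 0.
  by apply: contra_neq (piX_neq0 (k x)) => /(congr1 (@quat1 _ _ _)) /=; rewrite mulr1.
pose B' := [seq c x *: x | x <- B].
have oB' : orth_basis h B' by apply: orth_basis_scale.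
have vB' x : x \in B' -> valD (h x x) = 0 \/ valD (h x x) = 1.
  case/mapP=> d dB ->; rewrite normZ /c txZ invol1 mulr_algl mulr_algr scalerA.
  rewrite -expfzDr //.
  have hd : h d d != 0 by case/andP: (proj1 oB) => /allP/(_ d dB).
  have [_ -> _] := piX_scale (k d + k d) hd.
  by rewrite /k; move: (valD _); clear; lia.
pose p x := valD (h x x) == 0.
pose C := filter p B' ++ filter (predC p) B'.
have oC : orth_basis h C.
  by apply: orth_basis_perm oB'; rewrite perm_sym /C perm_filterC.
have hC x : x \in C -> h x x != 0 by move=> xC; case/andP: (proj1 oC) => /allP/(_ x xC).
have szC : size C = (size (filter p B') + size (filter (predC p) B'))%N by rewrite size_cat.
have hCi (i : 'I_(size (filter p B') + size (filter (predC p) B'))) : h C`_i C`_i != 0.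
  by apply: hC; apply: mem_nth; rewrite szC.
pose w (i : 'I_(size (filter p B') + size (filter (predC p) B'))) :=
  SymUnit (symunit_subproof divD (hform_diag_sym C`_i) (hCi i)).
have iso := orth_basis_isometry (u := w) szC oC (fun i => erefl).
exists _, (fun i => w (lshift _ i)), _, (fun j => w (rshift _ j)); split.
- exact: isometry_trans (isometry_sym iso) (diag_osum w).
- move=> i; rewrite nuDE ?hCi //=.
  have : C`_i \in filter p B' by rewrite nth_cat ltn_ord mem_nth.
  by rewrite mem_filter => /andP[/eqP -> _].
- move=> j; rewrite nuDE ?hCi // nuD_pi' /=.
  have : C`_(size (filter p B') + j) \in filter (predC p) B'.
    by rewrite nth_cat ltnNge leq_addr /= addKn mem_nth.
  rewrite mem_filter => /andP[/= pj /vB'[] e]; last by rewrite e.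
  by rewrite /p e eqxx in pj.
Qed.

Lemma OD_unit_nuD d : OD_unit nu d -> d != 0 /\ nuD nu d = 0.
Proof.
case/and3P=> dO dU dVO.
have d0 : d != 0 by apply: contraTneq dU => ->; rewrite unitr0.
split=> //; rewrite nuDE //.
move: dO dVO; rewrite !OD_qge !qgeE ?invD_neq0 // (valDV d0) oppr_ge0 => v0 v1.
by rewrite (@le_anti _ _ (valD d) 0) // v0 v1.
Qed.

Lemma residue_class_unramified (u : symunit tx false) : nuD nu (suval u) = 0 ->
  exists2 ubar : symunit txbar false, suval ubar = red (suval u)
    & residue_class (suval u) = (unit_class txbar (suval ubar), 0).
Proof.
have u0 := suval_neq0 u; have uS := suval_sym u.
rewrite nuDE // => /eqP; rewrite intr_eq0 => /eqP v0.
have lE : lcoef (suval u) = red (suval u) by rewrite /lcoef v0 oppr0 expr0z scale1r.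
exists (SymUnit (symunit_subproof residue_division (lcoef_sym uS) (lcoef_neq0 u0))) => //=.
by rewrite /residue_class v0 lE.
Qed.

Lemma residue_class_ramified (v : symunit tx false) : nuD nu (suval v) = 1 ->
  exists2 vbar : symunit txbar false, suval vbar = red (pi^-1 *: suval v)
    & residue_class (suval v) = (0, unit_class txbar (suval vbar)).
Proof.
have v0 := suval_neq0 v; have vS := suval_sym v.
rewrite nuDE // => /(@intr_inj rat _ 1) v1.
have lE : lcoef (suval v) = red (pi^-1 *: suval v) by rewrite /lcoef v1 exprN1.
exists (SymUnit (symunit_subproof residue_division (lcoef_sym vS) (lcoef_neq0 v0))) => //=.
by rewrite /residue_class v1 lE.
Qed.

Section ResidueMap.
Variable partial : {additive witt tx false -> (Wbar * Wbar)%type}.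
Hypothesis partialE : forall u, u != 0 -> tx u = u ->
  partial (unit_class tx u) = residue_class u.

Lemma partial_diag (n : nat) (u : 'I_n -> symunit tx false) :
  partial (witt_class (diag_form u)) = \sum_i residue_class (suval (u i)).
Proof.
rewrite witt_class_diag raddf_sum; apply: eq_bigr => i _.
by apply: partialE; [apply: suval_neq0 | apply: suval_sym].
Qed.

Lemma partial_is_larmour : is_larmour pi' partial.
Proof.
move=> h; split; first exact: larmour_decomposition_ex.
move=> q u r v [iso hu hv].
have /boolp.choice[ubar ubarE] : forall i, exists x : symunit txbar false,
    suval x = red (suval (u i)) /\
    residue_class (suval (u i)) = (unit_class txbar (suval x), 0).
  by move=> i; have [x xE cE] := residue_class_unramified (hu i); exists x.
have /boolp.choice[vbar vbarE] : forall j, exists x : symunit txbar false,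
    suval x = red (pi^-1 *: suval (v j)) /\
    residue_class (suval (v j)) = (0, unit_class txbar (suval x)).
  move=> j; have vj : nuD nu (suval (v j)) = 1 by rewrite hv nuD_pi'.
  by have [x xE cE] := residue_class_ramified vj; exists x.
exists ubar, vbar; split=> [i|j|]; first by case: (ubarE i).
  by rewrite pi'_inv; case: (vbarE j).
rewrite (witt_class_isometry iso) witt_class_osum raddfD !partial_diag !witt_class_diag.
rewrite (eq_bigr _ (fun i _ => proj2 (ubarE i))) (eq_bigr _ (fun j _ => proj2 (vbarE j))).
have suml (n : nat) (F : 'I_n -> Wbar) : \sum_i (F i, 0 : Wbar) = (\sum_i F i, 0).
  by elim/big_rec2: _ => // i x y _ ->; congr (_, _); rewrite addr0.
have sumr (n : nat) (F : 'I_n -> Wbar) : \sum_i (0 : Wbar, F i) = (0, \sum_i F i).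
  by elim/big_rec2: _ => // i x y _ ->; congr (_, _); rewrite addr0.
rewrite suml sumr; congr (_, _); [exact: addr0 | exact: add0r].
Qed.

End ResidueMap.

(** The inverse adds up the lifts with k = 0 of the first component and with
    k = 1 of the second; all composites are additive, so they need to be compared
    on generators only. *)
Lemma partial_bijective (partial : {additive witt tx false -> (Wbar * Wbar)%type}) :
  (forall u, u != 0 -> tx u = u -> partial (unit_class tx u) = residue_class u) ->
  bijective partial.
Proof.
move=> partialE.
have [Psi0 Psi0E] := witt_lift residue_division twoDbar (lift_class_invariant 0).
have [Psi1 Psi1E] := witt_lift residue_division twoDbar (lift_class_invariant 1).
pose Psi (w : Wbar * Wbar) := Psi0 w.1 + Psi1 w.2.
have PsiB w w' : Psi (w - w') = Psi w - Psi w'.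
  by rewrite /Psi /= !raddfB opprD addrACA.
have Psi_class u : u != 0 -> tx u = u -> Psi (residue_class u) = unit_class tx u.
  move=> u0 uS; have l0 := lcoef_neq0 u0; have lS := lcoef_sym uS.
  rewrite /Psi /residue_class /parity_inj; case: ifP => hk /=.
    by rewrite raddf0 add0r Psi1E // lift_classE // hk.
  by rewrite raddf0 addr0 Psi0E // lift_classE // hk.
exists Psi.
  apply: (witt_additive_ext divD twoD (f := fun x => Psi (partial x)) (g := id)) => //.
    by move=> x y; rewrite raddfB PsiB.
  by move=> u u0 uS; rewrite partialE // Psi_class.
have partial_lift k (Psik : {additive Wbar -> witt tx false}) :
    (forall e : Dbar, e != 0 -> txbar e = e -> Psik (unit_class txbar e) = lift_class k e) ->
    forall w, partial (Psik w) = parity_inj k w.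
  move=> PsikE; apply: (witt_additive_ext residue_division twoDbar).
  - by move=> x y; rewrite !raddfB.
  - move=> x y; rewrite /parity_inj; case: odd; congr (_, _); rewrite ?subr0 //.
  - move=> e e0 eS; have [s0 s1 _ _] := scaled_sym_reprP k e0 eS.
    rewrite (PsikE e e0 eS).
    have key : partial (unit_class tx (pi ^ k *: sym_repr e)) = parity_inj k (unit_class txbar e).
      rewrite (partialE _ s0 s1).
      exact: residue_class_lift.
    exact: key.
case=> x y; rewrite /Psi raddfD (partial_lift 0 Psi0) // (partial_lift 1 Psi1) //.
by congr (_, _); rewrite ?addr0 ?add0r.
Qed.

End QuaternionValuation.

(** * The isomorphism *)

Theorem mainTheorem8 (K : fieldType) (nu : cdvaluation K)
    (char_residue : 2%N \notin [pchar residue_field nu])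
    (pi : K) (pi_neq0 : pi != 0) (nu_pi : nu pi = 1)
    (a b : K) (a_unit : vunit nu a) (b_unit : vunit nu b)
    (divD : is_division (quat a b)) :
  let tx := tau_x b (vunit_neq0 a_unit) in
  let tx_bar := tau_x (residue nu b) (residue_neq0 a_unit) in
  let pi' : quat a b := pi%:A in
  let elt (delta beta gamma : K) : quat a b :=
    delta%:A + beta *: qy a b + gamma *: qz a b in
  [/\ is_division (quat (residue nu a) (residue nu b)),
      red_is_reduction nu a b,
      induces tx tx_bar
    & twist tx pi' =1 tx] /\
  exists partial : {additive witt tx false ->
                      (witt tx_bar false * witt tx_bar false)%type},
    [/\ is_larmour pi' partial,
        bijective partial,
        forall delta beta gamma : K,
          delta \in vring nu -> beta \in vring nu -> gamma \in vring nu ->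
          OD_unit nu (elt delta beta gamma) ->
          exists (u : symunit tx false) (ubar : symunit tx_bar false),
            [/\ suval u = elt delta beta gamma,
                suval ubar = red nu (elt delta beta gamma)
              & (partial (witt_class (diag1 u))).1 = witt_class (diag1 ubar)]
      & forall delta beta gamma : K,
          delta \in vmax nu -> beta \in vmax nu -> gamma \in vmax nu ->
          elt delta beta gamma != 0 -> nuD nu (elt delta beta gamma) = 1 ->
          exists (v : symunit tx false) (vbar : symunit tx_bar false),
            [/\ suval v = elt delta beta gamma,
                suval vbar = red nu (pi^-1 *: elt delta beta gamma)
              & (partial (witt_class (diag1 v))).2 = witt_class (diag1 vbar)]].
Proof.
move=> tx tx_bar pi' elt.
have resdiv : is_division (quat (residue nu a) (residue nu b)).
  exact: (residue_division char_residue a_unit b_unit divD).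
split.
  split=> //.
  - exact: (red_reduction char_residue pi_neq0 nu_pi a_unit b_unit divD).
  - exact: (tx_induces char_residue pi_neq0 nu_pi a_unit b_unit divD).
  - exact: twist_central.
have two0 : (2 : K) != 0 by case: (two_vunit char_residue).
have finv := residue_class_invariant char_residue pi_neq0 nu_pi a_unit b_unit divD.
have [partial partialE] := witt_lift divD (quat_two_neq0 a b two0) finv.
have eltE delta beta gamma : elt delta beta gamma = Quat a b delta 0 beta gamma.
  by apply: quatP => /=; ring.
have eltS delta beta gamma : tx (elt delta beta gamma) = elt delta beta gamma.
  by rewrite eltE; apply/tau_x_sym.
exists partial; split.
- exact: (partial_is_larmour char_residue pi_neq0 nu_pi b_unit divD partialE).
- exact: (partial_bijective char_residue pi_neq0 nu_pi b_unit divD partialE).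
- move=> delta beta gamma _ _ _ /(OD_unit_nuD char_residue pi_neq0 nu_pi a_unit b_unit divD)[d0 dv].
  pose u := SymUnit (symunit_subproof divD (eltS delta beta gamma) d0).
  have [ubar ubarE cE] := residue_class_unramified char_residue pi_neq0 nu_pi b_unit divD (u := u) dv.
  exists u, ubar; split=> //.
  by rewrite -!unit_classE partialE ?suval_neq0 ?suval_sym // cE.
- move=> delta beta gamma _ _ _ d0 dv.
  pose v := SymUnit (symunit_subproof divD (eltS delta beta gamma) d0).
  have [vbar vbarE cE] := residue_class_ramified char_residue pi_neq0 nu_pi b_unit divD (v := v) dv.
  exists v, vbar; split=> //.
  by rewrite -!unit_classE partialE ?suval_neq0 ?suval_sym // cE.
Qed.
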